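(* (a) Let $\mathfrak g$ be one of $\mathfrak{vect}(0|n)$ with $n>2$, $\mathfrak{svect}(0|n)$ with $n>2$, or $\mathfrak h(0|n)$ with $n>4$, with its standard $\mathbb Z$-grading $\mathfrak g=\bigoplus_{i\ge -1}\mathfrak g_i$. Let $\mathfrak b$ be a maximal solvable Lie subalgebra of $\mathfrak g_0$ and set $$\mathfrak{ms}0^{\mathfrak g}:=\mathfrak b\oplus\Bigl(\bigoplus_{i>0}\mathfrak g_i\Bigr).$$ Then $\mathfrak{ms}0^{\mathfrak g}$ is maximal solvable in $\mathfrak g$. (b) Moreover, let $n\ge 2$. The subsuperalgebra of $\widetilde{\mathfrak{svect}}(0|2n)$ isomorphic to $\mathfrak{ms}0^{\mathfrak{svect}(0|2n)}$, namely $\mathfrak b\oplus\bigoplus_{i>0}\widetilde{\mathfrak{svect}}_i(0|2n)$ with $\mathfrak b$ a maximal solvable subalgebra of $\widetilde{\mathfrak{svect}}_0(0|2n)=\mathfrak{svect}_0(0|2n)$, is maximal solvable in $\widetilde{\mathfrak{svect}}(0|2n)$.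
   Context: The ground field is $\mathbb C$; all spaces are finite-dimensional. $\Lambda(n)$ is the Grassmann algebra on generators $\xi_1,\dots,\xi_n$, graded by $\deg\xi_i=1$, with parity $p$ equal to the degree modulo 2. $\mathfrak{vect}(0|n)$ is the Lie superalgebra of superderivations $\sum f_i\partial_i$ of $\Lambda(n)$, where $f_i\in\Lambda(n)$ and $\partial_i\xi_j=\delta_{ij}$. It is $\mathbb Z$-graded with $\deg(f\partial_i)=\deg f-1$, so degrees start at $-1$. $\mathfrak{svect}(0|n)=\{D\in\mathfrak{vect}(0|n)\mid \mathrm{Div}\,D=0\}$, where $\mathrm{Div}(\sum f_i\partial_i)=\sum(-1)^{p(f_i)}\partial_i(f_i)$, with the induced grading. For $n=2k+l$, write the generators of $\Lambda(n)$ as $\xi_1,\dots,\xi_k,\eta_1,\dots,\eta_k,\zeta_1,\dots,\zeta_l$. Then $\mathfrak h(0|n)=\mathrm{Span}\{H_f\mid f\in\Lambda(n)\}\subset\mathfrak{vect}(0|n)$, where $$H_f=(-1)^{p(f)}\Bigl(\sum_{i\le k}\bigl(\tfrac{\partial f}{\partial\xi_i}\partial_{\eta_i}+\tfrac{\partial f}{\partial\eta_i}\partial_{\xi_i}\bigr)+\sum_{j\le l}\tfrac{\partial f}{\partial\zeta_j}\partial_{\zeta_j}\Bigr),$$ with $\deg H_f=\deg f-2$ for homogeneous non-constant $f$. One has $\mathfrak g_0\simeq\mathfrak{gl}(n),\mathfrak{sl}(n),\mathfrak o(n)$ for $\mathfrak{vect},\mathfrak{svect},\mathfrak h$, respectively.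 With $2n$ generators $\xi_1,\dots,\xi_{2n}$ and $\Xi=\xi_1\cdots\xi_{2n}$, put $\widetilde{\mathfrak{svect}}(0|2n)=(1+\Xi)\,\mathfrak{svect}(0|2n)\subset\mathfrak{vect}(0|2n)$. It is $\mathbb Z/2n\mathbb Z$-graded with degrees represented by $-1,0,\dots,2n-2$: the degree $-1$ component is $\mathrm{Span}((1+\Xi)\partial_1,\dots,(1+\Xi)\partial_{2n})$, and the degree $i$ component is $\widetilde{\mathfrak{svect}}_i(0|2n)=\mathfrak{svect}_i(0|2n)$ for $i\ge0$. A Lie subsuperalgebra $\mathfrak s\subset\mathfrak g$ is graded if $\mathfrak s=\bigoplus_i(\mathfrak s\cap\mathfrak g_i)$. ''Maximal solvable in $\mathfrak g$'' means: solvable, graded, and not properly contained in any graded solvable Lie subsuperalgebra of $\mathfrak g$. *)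

(* Defs.v *)
From HB Require Import structures.
From mathcomp Require Import all_boot all_order all_algebra all_field.
From mathcomp Require Export complex.
From mathcomp Require Export reals.

Set Implicit Arguments.
Unset Strict Implicit.
Unset Printing Implicit Defensive.

Import GRing.Theory.
Local Open Scope ring_scope.

(* An element f of the Grassmann algebra is the family of its coordinates:
   f S is the coefficient of the monomial xi_S, the product of the xi_i, i in S,
   taken in increasing order of the indices. *)
Definition grassmann (F : fieldType) (n : nat) : Type :=
  {ffun {set 'I_n} -> F^o}.

HB.instance Definition _ (F : fieldType) (n : nat) :=
  Vector.copy (grassmann F n) {ffun {set 'I_n} -> F^o}.

Section GrassmannAlgebra.
Variables (F : fieldType) (n : nat).
Local Notation L := (grassmann F n).
Implicit Types (S T U W : {set 'I_n}) (f g h : L) (a : F) (i j : 'I_n).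

Definition monomial S : L := [ffun T => (T == S)%:R].

Definition inversions S T : nat := (\sum_(i in S) \sum_(j in T) (j < i))%N.

(* xi_S * xi_T = monomial_sign S T *: xi_(S :|: T) *)
Definition monomial_sign S T : F :=
  if [disjoint S & T] then (-1) ^+ inversions S T else 0.

Definition grassmann_mul f g : L :=
  [ffun U => \sum_S \sum_(T | S :|: T == U) monomial_sign S T * (f S * g T)].

Lemma disjoint_setUl S T U :
  [disjoint S :|: T & U] = [disjoint S & U] && [disjoint T & U].
Proof. by rewrite -!setI_eq0 setIUl setU_eq0. Qed.

Lemma disjoint_setUr S T U :
  [disjoint S & T :|: U] = [disjoint S & T] && [disjoint S & U].
Proof. by rewrite -!setI_eq0 setIUr setU_eq0. Qed.

Lemma big_disjoint_setU S T (E : 'I_n -> nat) : [disjoint S & T] ->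
  (\sum_(i in S :|: T) E i = \sum_(i in S) E i + \sum_(i in T) E i)%N.
Proof.
move=> dST; rewrite -bigU //=; apply: eq_bigl => i.
by rewrite !inE.
Qed.

Lemma inversionsUl S T U : [disjoint S & T] ->
  inversions (S :|: T) U = (inversions S U + inversions T U)%N.
Proof. exact: big_disjoint_setU. Qed.

Lemma inversionsUr S T U : [disjoint T & U] ->
  inversions S (T :|: U) = (inversions S T + inversions S U)%N.
Proof.
move=> dTU; rewrite /inversions -big_split /=.
by apply: eq_bigr => i _; rewrite big_disjoint_setU.
Qed.

Lemma monomial_signA S T U :
  monomial_sign S T * monomial_sign (S :|: T) U =
  monomial_sign T U * monomial_sign S (T :|: U).
Proof.
rewrite /monomial_sign disjoint_setUl disjoint_setUr.
have [dST|] := boolP [disjoint S & T]; have [dTU|] := boolP [disjoint T & U];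
  have [dSU|] := boolP [disjoint S & U]; rewrite ?mul0r ?mulr0 //=.
by rewrite inversionsUl // inversionsUr // -!exprD addnA [RHS]exprD mulrC -exprD.
Qed.

Lemma monomial_sign0l S : monomial_sign set0 S = 1.
Proof.
by rewrite /monomial_sign -setI_eq0 set0I eqxx /inversions big_set0.
Qed.

Lemma monomial_sign0r S : monomial_sign S set0 = 1.
Proof.
rewrite /monomial_sign -setI_eq0 setI0 eqxx /inversions.
by rewrite big1 // => i _; rewrite big_set0.
Qed.

Lemma monomialE S T : monomial S T = (T == S)%:R.
Proof. by rewrite ffunE. Qed.

Lemma grassmann_sum f : f = \sum_S (f S : F) *: monomial S.
Proof.
apply/ffunP => U; rewrite sum_ffunE (bigD1 U) //= !ffunE eqxx.
rewrite big1 ?addr0; first by rewrite /GRing.scale /= mulr1.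
by move=> T nTU; rewrite !ffunE eq_sym (negPf nTU) scaler0.
Qed.

Fact grassmann_mulDl : left_distributive grassmann_mul +%R.
Proof.
move=> f g h; apply/ffunP => U; rewrite !ffunE -big_split /=.
apply: eq_bigr => S _; rewrite -big_split /=; apply: eq_bigr => T _.
by rewrite ffunE mulrDl mulrDr.
Qed.

Fact grassmann_mulDr : right_distributive grassmann_mul +%R.
Proof.
move=> f g h; apply/ffunP => U; rewrite !ffunE -big_split /=.
apply: eq_bigr => S _; rewrite -big_split /=; apply: eq_bigr => T _.
by rewrite ffunE !mulrDr.
Qed.

Fact grassmann_scaleAl a f g :
  a *: grassmann_mul f g = grassmann_mul (a *: f) g.
Proof.
apply/ffunP => U; rewrite !ffunE [LHS]mulr_sumr.
apply: eq_bigr => S _; rewrite mulr_sumr; apply: eq_bigr => T _.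
by rewrite ffunE /= -[_ *: f S]/(a * f S) !mulrA [a * _]mulrC.
Qed.

Fact grassmann_scaleAr a f g :
  a *: grassmann_mul f g = grassmann_mul f (a *: g).
Proof.
apply/ffunP => U; rewrite !ffunE [LHS]mulr_sumr.
apply: eq_bigr => S _; rewrite mulr_sumr; apply: eq_bigr => T _.
by rewrite ffunE /= -[_ *: g T]/(a * g T) (mulrCA (f S)) [RHS]mulrCA.
Qed.

Lemma grassmann_mul_monomial S T :
  grassmann_mul (monomial S) (monomial T) =
  monomial_sign S T *: monomial (S :|: T).
Proof.
apply/ffunP => U; rewrite !ffunE (bigD1 S) //= [X in _ + X]big1 ?addr0.
  have [->|nU] := eqVneq U (S :|: T).
    rewrite (bigD1 T) //= [X in _ + X]big1 ?addr0 => [|T' /andP[_ /negPf nT]].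
      by rewrite !monomialE !eqxx mulr1.
    by rewrite !monomialE nT !mulr0.
  rewrite scaler0 big1 // => T' /eqP ST'; rewrite !monomialE.
  case: (T' =P T) => [T'T|]; last by rewrite !mulr0.
  by rewrite -ST' T'T eqxx in nU.
move=> S' /negPf nS; rewrite big1 // => T' _.
by rewrite !monomialE nS mul0r mulr0.
Qed.

Fact grassmann_mul_suml (I : finType) (E : I -> L) g :
  grassmann_mul (\sum_k E k) g = \sum_k grassmann_mul (E k) g.
Proof.
apply: (big_morph (grassmann_mul^~ g)) => [x y|]; first exact: grassmann_mulDl.
by rewrite -[0](scale0r 0) -grassmann_scaleAl !scale0r.
Qed.

Fact grassmann_mul_sumr (I : finType) (E : I -> L) f :
  grassmann_mul f (\sum_k E k) = \sum_k grassmann_mul f (E k).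
Proof.
apply: (big_morph (grassmann_mul f)) => [x y|]; first exact: grassmann_mulDr.
by rewrite -[0](scale0r 0) -grassmann_scaleAr !scale0r.
Qed.

Fact grassmann_mulA : associative grassmann_mul.
Proof.
move=> f g h; rewrite (grassmann_sum f) (grassmann_sum g) (grassmann_sum h).
rewrite !grassmann_mul_suml; apply: eq_bigr => S _.
rewrite grassmann_mul_sumr [X in _ = grassmann_mul X _]grassmann_mul_sumr.
rewrite grassmann_mul_suml; apply: eq_bigr => T _.
rewrite !grassmann_mul_sumr; apply: eq_bigr => U _.
do !rewrite -?grassmann_scaleAl -?grassmann_scaleAr ?grassmann_mul_monomial.
rewrite !scalerA setUA -!mulrA; congr (_ *: _).
by rewrite monomial_signA; congr (_ * _); rewrite mulrCA.
Qed.

Fact grassmann_mul1f : left_id (monomial set0) grassmann_mul.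
Proof.
move=> f; rewrite [in LHS](grassmann_sum f) [in RHS](grassmann_sum f).
rewrite grassmann_mul_sumr; apply: eq_bigr => S _.
by rewrite -grassmann_scaleAr grassmann_mul_monomial monomial_sign0l scale1r
  set0U.
Qed.

Fact grassmann_mulf1 : right_id (monomial set0) grassmann_mul.
Proof.
move=> f; rewrite [in LHS](grassmann_sum f) [in RHS](grassmann_sum f).
rewrite grassmann_mul_suml; apply: eq_bigr => S _.
by rewrite -grassmann_scaleAl grassmann_mul_monomial monomial_sign0r scale1r
  setU0.
Qed.

Fact grassmann_1neq0 : monomial set0 != 0.
Proof.
apply/eqP => /ffunP/(_ set0); rewrite !ffunE eqxx; exact/eqP/oner_neq0.
Qed.

End GrassmannAlgebra.

HB.instance Definition _ (F : fieldType) (n : nat) :=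
  GRing.Zmodule_isNzRing.Build (grassmann F n) (@grassmann_mulA F n)
    (@grassmann_mul1f F n) (@grassmann_mulf1 F n) (@grassmann_mulDl F n)
    (@grassmann_mulDr F n) (@grassmann_1neq0 F n).

HB.instance Definition _ (F : fieldType) (n : nat) :=
  GRing.Lmodule_isLalgebra.Build F (grassmann F n) (@grassmann_scaleAl F n).

HB.instance Definition _ (F : fieldType) (n : nat) :=
  GRing.Lalgebra_isAlgebra.Build F (grassmann F n) (@grassmann_scaleAr F n).

HB.instance Definition _ (F : fieldType) (n : nat) :=
  Algebra_isFalgebra.Build F (grassmann F n).

Section LieSuperalgebras.
Variables (F : fieldType) (n : nat).
Local Notation L := (grassmann F n).
Local Notation E := 'End(L).
Implicit Types (f g : L) (D : E) (U V s t : {vspace E}) (b c : bool).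

Definition parity_part_fun b f : L :=
  [ffun S : {set 'I_n} => if odd #|S| == b then f S else 0].

Fact parity_part_fun_is_linear b : linear (parity_part_fun b).
Proof.
move=> a f g; apply/ffunP => S; rewrite !ffunE.
by case: ifP => // _; rewrite scaler0 addr0.
Qed.

HB.instance Definition _ b := GRing.isSemilinear.Build F L L _
  (parity_part_fun b) (GRing.semilinear_linear (parity_part_fun_is_linear b)).

(* the projection of f to its even (b = false) or odd (b = true) part *)
Definition parity_part b : E := linfun (parity_part_fun b).

(* f |-> (-1)^p(f) f *)
Definition parity_sign : E := parity_part false - parity_part true.

(* The even or odd part of an operator, an operator being of parity b if it
   maps elements of parity c to elements of parity b + c. *)
Definition op_part b D : E :=
  \sum_(c : bool) (parity_part (b (+) c) \o D \o parity_part c)%VF.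

(* the bilinear extension of [D, D'] = D D' - (-1)^(p(D) p(D')) D' D *)
Definition superbracket D D' : E :=
  \sum_(b : bool) \sum_(c : bool)
    ((op_part b D \o op_part c D')%VF
       - (-1) ^+ (b && c) *: (op_part c D' \o op_part b D)%VF).

(* by bilinearity, the span of all the [D, D'] with D in U and D' in V *)
Definition superbracketv U V : {vspace E} :=
  <<[seq superbracket D D' | D <- vbasis U, D' <- vbasis V]>>%VS.

Definition lie_closed s : Prop := (superbracketv s s <= s)%VS.

Definition derived_series s (m : nat) : {vspace E} :=
  iter m (fun t => superbracketv t t) s.

Definition lie_solvable s : Prop := exists m, derived_series s m = 0%VS.

(* A subspace of the operators on the Grassmann algebra together with its
   homogeneous components. Only the components of degree in gdegrees matter;
   in the case of a Z/mZ-grading, gdegrees contains one representative of each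
   class modulo m. *)
Record graded_space := GradedSpace {
  gtotal :> {vspace E};
  gdegrees : seq int;
  gcomp : int -> {vspace E}
}.

Definition is_graded (g : graded_space) s : Prop :=
  s = (\sum_(d <- gdegrees g) (s :&: gcomp g d))%VS.

(* For the gradings below, parity is degree modulo 2, so that is_graded implies
   that s is the sum of its even and odd parts. *)
Definition graded_solvable (g : graded_space) s : Prop :=
  [/\ (s <= g)%VS, lie_closed s, is_graded g s & lie_solvable s].

Definition maximal_solvable (g : graded_space) s : Prop :=
  graded_solvable g s /\
  forall t, graded_solvable g t -> (s <= t)%VS -> t = s.

(* used for V = g_0, on which the grading imposes no condition *)
Definition solvable_subalgebra V s : Prop :=
  [/\ (s <= V)%VS, lie_closed s & lie_solvable s].

Definition maximal_solvable_subalgebra V s : Prop :=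
  solvable_subalgebra V s /\
  forall t, solvable_subalgebra V t -> (s <= t)%VS -> t = s.

Definition ms0 (g : graded_space) (b : {vspace E}) : {vspace E} :=
  (b + \sum_(d <- gdegrees g | (0 < d)%R) gcomp g d)%VS.

End LieSuperalgebras.

Section VectorFields.
Variables (F : fieldType) (n : nat).
Local Notation L := (grassmann F n).
Local Notation E := 'End(L).
Implicit Types (f g : L) (D : E) (i j : 'I_n) (S T : {set 'I_n}) (d : int).

Definition generator i : L := monomial F [set i].

(* the left derivative: passing xi_i to the front of xi_S costs one sign for
   each j in S smaller than i *)
Definition partial_fun i f : L :=
  [ffun T : {set 'I_n} => if i \in T then 0
             else (-1) ^+ #|[set j in T | (j < i)%N]| *: f (i |: T)].

Fact partial_fun_is_linear i : linear (partial_fun i).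
Proof.
move=> a f g; apply/ffunP => T; rewrite !ffunE.
case: ifP => _; first by rewrite scaler0 addr0.
by rewrite scalerDr !scalerA [a * _]mulrC.
Qed.

HB.instance Definition _ i := GRing.isSemilinear.Build F L L _
  (partial_fun i) (GRing.semilinear_linear (partial_fun_is_linear i)).

Definition partial i : E := linfun (partial_fun i).

Definition vfield_fun i f : E := (amull f \o partial i)%VF.

Fact vfield_fun_is_linear i : linear (vfield_fun i).
Proof.
by move=> a f g; rewrite /vfield_fun linearP comp_lfunDl comp_lfunZl.
Qed.

HB.instance Definition _ i := GRing.isSemilinear.Build F L E _
  (vfield_fun i) (GRing.semilinear_linear (vfield_fun_is_linear i)).

(* f |-> f partial_i *)
Definition vfield i : 'Hom(L, E) := linfun (vfield_fun i).

Definition homogeneous d : {vspace L} :=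
  <<[seq monomial F A | A : {set 'I_n} in [pred A : {set 'I_n} | #|A|%:Z == d]]>>%VS.

Definition degrees_from_m1 (m : nat) : seq int :=
  [seq k%:Z - 1 | k <- iota 0 m].

Definition vect_total : {vspace E} := (\sum_i limg (vfield i))%VS.

Definition vect_comp d : {vspace E} :=
  (\sum_i vfield i @: homogeneous (d + 1))%VS.

Definition vect : graded_space F n :=
  GradedSpace vect_total (degrees_from_m1 n.+1) vect_comp.

(* D (generator i) is the coefficient f_i of D = \sum_i f_i partial_i *)
Definition divergence_fun D : L :=
  \sum_i partial i (parity_sign F n (D (generator i))).

Fact divergence_fun_is_linear : linear divergence_fun.
Proof.
move=> a D D'; rewrite /divergence_fun scaler_sumr -big_split /=.
apply: eq_bigr => i _.
have -> : (a *: D + D') (generator i) = a *: D (generator i) + D' (generator i).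
  by rewrite !lfun_simp.
by rewrite !linearP.
Qed.

HB.instance Definition _ := GRing.isSemilinear.Build F E L _
  divergence_fun (GRing.semilinear_linear divergence_fun_is_linear).

Definition divergence : 'Hom(E, L) := linfun divergence_fun.

Definition svect_comp d : {vspace E} := (vect_comp d :&: lker divergence)%VS.

Definition svect : graded_space F n :=
  GradedSpace (vect_total :&: lker divergence) (degrees_from_m1 n.+1)
    svect_comp.

Definition top_monomial : L := monomial F [set: 'I_n].

Definition twist_fun D : E := (amull (1 + top_monomial) \o D)%VF.

Fact twist_fun_is_linear : linear twist_fun.
Proof. by move=> a D D'; rewrite /twist_fun comp_lfunDr comp_lfunZr. Qed.

HB.instance Definition _ := GRing.isSemilinear.Build F E E _
  twist_fun (GRing.semilinear_linear twist_fun_is_linear).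

(* D |-> (1 + xi_1 ... xi_n) D *)
Definition twist : 'End(E) := linfun twist_fun.

(* Meant for even n; the degrees are representatives modulo n. *)
Definition tsvect_comp d : {vspace E} :=
  if d == -1 then <<[seq twist (partial i) | i : 'I_n]>>%VS else svect_comp d.

Definition tsvect : graded_space F n :=
  GradedSpace (twist @: svect) (degrees_from_m1 n) tsvect_comp.

End VectorFields.

Section Hamiltonian.
Variables (F : fieldType) (k l : nat).
Local Notation L := (grassmann F (k + k + l)).
Local Notation E := 'End(L).

(* the generators are numbered as xi_1..xi_k, eta_1..eta_k, zeta_1..zeta_l *)
Definition xi_index (i : 'I_k) : 'I_(k + k + l) := lshift l (lshift k i).
Definition eta_index (i : 'I_k) : 'I_(k + k + l) := lshift l (rshift k i).
Definition zeta_index (j : 'I_l) : 'I_(k + k + l) := rshift (k + k) j.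

Definition hamiltonian_fun (f : L) : E :=
  let h := parity_sign F (k + k + l) f in
  \sum_(i < k) (vfield F (eta_index i) (partial F (xi_index i) h)
                + vfield F (xi_index i) (partial F (eta_index i) h))
  + \sum_(j < l) vfield F (zeta_index j) (partial F (zeta_index j) h).

Fact hamiltonian_fun_is_linear : linear hamiltonian_fun.
Proof.
move=> a f g; rewrite /hamiltonian_fun scalerDr !scaler_sumr addrACA.
rewrite -!big_split /=; congr (_ + _); apply: eq_bigr => i _.
  by rewrite !linearP /= scalerDr addrACA.
by rewrite !linearP.
Qed.

HB.instance Definition _ := GRing.isSemilinear.Build F L E _
  hamiltonian_fun (GRing.semilinear_linear hamiltonian_fun_is_linear).

(* f |-> H_f *)
Definition hamiltonian : 'Hom(L, E) := linfun hamiltonian_fun.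

Definition hvect_comp (d : int) : {vspace E} :=
  (hamiltonian @: homogeneous F (k + k + l) (d + 2))%VS.

Definition hvect : graded_space F (k + k + l) :=
  GradedSpace (limg hamiltonian) (degrees_from_m1 (k + k + l).+1) hvect_comp.

End Hamiltonian.

Section GrassmannTheory.
Variables (F : fieldType) (n : nat).
Local Notation L := (grassmann F n).
Implicit Types (S T U : {set 'I_n}) (f g : L) (i j : 'I_n).

Lemma monomialM S T :
  monomial F S * monomial F T = monomial_sign F S T *: monomial F (S :|: T).
Proof. exact: grassmann_mul_monomial. Qed.

Lemma inversions1l i T : inversions [set i] T = #|[set j in T | (j < i)%N]|.
Proof.
rewrite /inversions big_set1 -sum1_card [RHS](eq_bigl (fun j => (j \in T) && (j < i)%N)).
  by rewrite big_mkcondr.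
by move=> j; rewrite inE.
Qed.

Lemma inversions1r i S : inversions S [set i] = #|[set j in S | (i < j)%N]|.
Proof.
rewrite /inversions -sum1_card [RHS](eq_bigl (fun j => (j \in S) && (i < j)%N)).
  by rewrite big_mkcondr; apply: eq_bigr => j _; rewrite big_set1.
by move=> j; rewrite inE.
Qed.

(* xi_S is the product of the generators xi_i, i in S, in increasing order *)
Lemma monomial_prod S : monomial F S = \prod_(i in S) generator F i.
Proof.
rewrite -big_filter; set s := filter _ _.
have : sorted (fun i j : 'I_n => (i < j)%N) s.
  apply: sorted_filter => [j i k|]; first exact: ltn_trans.
  have := iota_ltn_sorted 0 n; rewrite -val_enum_ord sorted_map.
  by rewrite [X in X -> _]/= enumT.
have -> : S = [set:: s].
  by apply/setP => i; rewrite inE mem_filter mem_index_enum andbT.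
elim: s => [|i s IHs] ps; first by rewrite big_nil set_nil.
rewrite big_cons set_cons -IHs; last exact: path_sorted ps.
rewrite /generator monomialM /monomial_sign.
have lt_is j : j \in s -> (i < j)%N.
  have tr : transitive (fun i j : 'I_n => (i < j)%N).
    by move=> a b c; apply: ltn_trans.
  by move/(allP (order_path_min tr ps)).
have i_s : i \notin s by apply/negP => /lt_is; rewrite ltnn.
rewrite disjoints1 inE i_s inversions1l.
rewrite (_ : [set j in _ | _] = set0) ?cards0 ?scale1r //.
apply/setP => j; rewrite !inE; apply/negP => /andP[/lt_is ij ji].
by have := ltn_trans ij ji; rewrite ltnn.
Qed.

Lemma generatorN i j :
  generator F i * generator F j = - (generator F j * generator F i).
Proof.
rewrite /generator !monomialM /monomial_sign !disjoints1 !inE [j == i]eq_sym.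
have [//|nij] := eqVneq i j; first by rewrite !scale0r oppr0.
have E k m : inversions [set k] [set m] = (m < k)%N.
  by rewrite /inversions !big_set1.
rewrite setUC -scaleNr !E; congr (_ *: _).
case: ltngtP (nij : (i != j :> nat)%N) => // _ _; by rewrite ?expr0 ?expr1 ?opprK.
Qed.

Lemma generator_sq i : generator F i * generator F i = 0.
Proof.
by rewrite /generator monomialM /monomial_sign disjoints1 inE eqxx scale0r.
Qed.

Lemma partial_monomial i S : partial F i (monomial F S) =
  if i \in S then (-1) ^+ #|[set j in S | (j < i)%N]| *: monomial F (S :\ i)
  else 0.
Proof.
apply/ffunP => T; rewrite lfunE /= !ffunE; case: ifPn => iT.
  case: ifPn => iS; rewrite !ffunE //.
  by rewrite (_ : T == _ = false) ?scaler0 //; apply/eqP => eT; rewrite eT !inE eqxx in iT.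
case: ifPn => iS; rewrite !ffunE.
  have [eT|nT] := eqVneq T (S :\ i).
    rewrite eT setD1K // eqxx; congr (_ ^+ _ *: _).
    by apply: eq_card => j; rewrite !inE; case: eqVneq => [->|]; rewrite ?ltnn ?andbF.
  rewrite (_ : i |: T == S = false) ?scaler0 //; apply: contraNF nT => /eqP <-.
  by rewrite setU1K.
rewrite (_ : i |: T == S = false) ?scaler0 //; apply: contraNF iS => /eqP <-.
by rewrite setU11.
Qed.

Lemma partial_generator i j : partial F i (generator F j) = (i == j)%:R.
Proof.
rewrite /generator partial_monomial inE; case: eqVneq => [->|] //=.
rewrite setDv (_ : [set k in _ | _] = set0) ?cards0 ?scale1r //.
by apply/setP => k; rewrite !inE; case: eqVneq => // ->; rewrite ltnn.
Qed.

Lemma parity_sign_monomial S :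
  parity_sign F n (monomial F S) = (-1) ^+ #|S| *: monomial F S.
Proof.
apply/ffunP => T; rewrite /parity_sign !lfun_simp /= !ffunE.
have [->|] := eqVneq T S; last by rewrite scaler0 !if_same subr0.
by rewrite -signr_odd; case: odd; rewrite /= ?subr0 ?sub0r ?scale1r ?scaleN1r.
Qed.


Lemma grassmann_ind (P : L -> Prop) :
  (forall a f g, P f -> P g -> P (a *: f + g)) ->
  (forall S, P (monomial F S)) -> forall f, P f.
Proof.
move=> Plin Pmon f; rewrite (grassmann_sum f).
have P0 : P 0.
  by have := Plin (-1) _ _ (Pmon set0) (Pmon set0); rewrite scaleN1r addNr.
elim: index_enum => [|S s IHs]; first by rewrite big_nil.
by rewrite big_cons; apply: Plin.
Qed.

Lemma card_split_lt i S : #|S| =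
  (#|[set j in S | (j < i)%N]| + (i \in S) + #|[set j in S | (i < j)%N]|)%N.
Proof.
rewrite -(cardsID [set j : 'I_n | (j < i)%N] S) -addnA; congr (_ + _)%N.
  by apply: eq_card => j; rewrite !inE.
rewrite -(cardsID [set i] (_ :\: _)); congr (_ + _)%N.
  have [iS|iS] := boolP (i \in S).
    rewrite (_ : _ :&: _ = [set i]) ?cards1 //; apply/setP => j; rewrite !inE.
    by case: eqVneq => [->|]; rewrite ?andbF // ltnn iS.
  rewrite (_ : _ :&: _ = set0) ?cards0 //; apply/setP => j; rewrite !inE.
  by case: eqVneq => [->|]; rewrite ?andbF // (negPf iS) andbF.
apply: eq_card => j; rewrite !inE -val_eqE /=.
by case: (j \in S); rewrite ?andbF //= ?andbT; case: ltngtP.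
Qed.

Lemma card_ltU i S T : [disjoint S & T] ->
  #|[set j in S :|: T | (j < i)%N]| =
  (#|[set j in S | (j < i)%N]| + #|[set j in T | (j < i)%N]|)%N.
Proof.
move=> dST; rewrite -cardsUI.
have -> : [set j in S | (j < i)%N] :&: [set j in T | (j < i)%N] = set0.
  apply/setP => j; rewrite !inE andbACA andbb.
  by have /setP/(_ j) := disjoint_setI0 dST; rewrite !inE => ->.
by rewrite cards0 addn0; apply: eq_card => j; rewrite !inE andb_orl.
Qed.

Lemma partial_superderivation i f g :
  partial F i (f * g) = partial F i f * g + parity_sign F n f * partial F i g.
Proof.
elim/grassmann_ind: f => [a f1 f2 IH1 IH2|S].
  rewrite mulrDl -scalerAl !linearP /= IH1 IH2 !mulrDl -!scalerAl scalerDr.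
  by rewrite addrACA.
elim/grassmann_ind: g => [a g1 g2 IH1 IH2|T].
  rewrite mulrDr -scalerAr !linearP /= IH1 IH2 !mulrDr -!scalerAr scalerDr.
  by rewrite addrACA.
rewrite parity_sign_monomial monomialM linearZ /= !partial_monomial inE.
have ltU1 U : #|[set j in i |: U | (j < i)%N]| = #|[set j in U | (j < i)%N]|.
  by apply: eq_card => j; rewrite !inE; case: eqVneq => [->|]; rewrite ?ltnn ?andbF.
have invl (U V : {set 'I_n}) : i \notin U ->
    inversions (i |: U) V = (#|[set j in V | (j < i)%N]| + inversions U V)%N.
  by move=> iU; rewrite inversionsUl ?disjoints1 // inversions1l.
have invr U (V : {set 'I_n}) : i \notin V ->
    inversions U (i |: V) = (#|[set j in U | (i < j)%N]| + inversions U V)%N.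
  by move=> iV; rewrite inversionsUr ?disjoints1 // inversions1r.
have dl U (V : {set 'I_n}) : i \notin V -> [disjoint i |: U & V] = [disjoint U & V].
  by move=> iV; rewrite disjoint_setUl disjoints1 iV.
have dr (U V : {set 'I_n}) : i \notin U -> [disjoint U & i |: V] = [disjoint U & V].
  by move=> iU; rewrite disjoint_setUr disjoint_sym disjoints1 iU.
have [iS|iS] := boolP (i \in S); have [iT|iT] := boolP (i \in T); rewrite /=.
- rewrite -(setD1K iS) -(setD1K iT); move: (S :\ i) (T :\ i) (setD11 i S) (setD11 i T).
  move=> U V /negbT iU /negbT iV; rewrite !setU1K // !ltU1 !cardsU1 iU.
  rewrite -!scalerAl -!scalerAr !monomialM !scalerA (setUCA U) -!(setUA [set i]).
  rewrite /monomial_sign (dl U V iV) (dr U V iU) disjoint_setUl disjoints1 setU11 /= mul0r scale0r.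
  case: ifP => dUV; last by rewrite !mulr0 !scale0r addr0.
  rewrite invl // invr // -scalerDl -!exprD (card_split_lt i U) (negPf iU) /=.
  rewrite (_ : _ + _ = 0) ?scale0r //.
  rewrite -signr_odd -[X in _ + X]signr_odd !oddD /=.
  by do 4?case: (odd _); rewrite /= ?expr0 ?expr1 ?addNr ?subrr.
- rewrite -(setD1K iS); move: (S :\ i) (setD11 i S) => U /negbT iU.
  rewrite -!setUA !setU1K ?inE ?negb_or ?iU ?iT // mulr0 addr0 !ltU1.
  rewrite -!scalerAl !monomialM !scalerA /monomial_sign dl //.
  case: ifP => dUV; last by rewrite mul0r mulr0.
  rewrite invl // card_ltU // -!exprD -signr_odd -[in RHS]signr_odd !oddD.
  by do 4?case: (odd _).
- rewrite -(setD1K iT); move: (T :\ i) (setD11 i T) => V /negbT iV.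
  rewrite setUCA !setU1K ?inE ?negb_or ?iV ?iS // !ltU1 mul0r add0r.
  rewrite -!scalerAl -!scalerAr !monomialM !scalerA /monomial_sign dr //.
  case: ifP => dUV; last by rewrite mul0r mulr0.
  rewrite invr // card_ltU // -!exprD (card_split_lt i S) (negPf iS).
  rewrite -signr_odd -[in RHS]signr_odd !oddD.
  by do 4?case: (odd _).
- by rewrite scaler0 mul0r mulr0 addr0.
Qed.


Lemma parity_partM (b c : bool) :
  (parity_part F n b \o parity_part F n c)%VF =
  if b == c then parity_part F n b else 0.
Proof.
apply/lfunP => f; rewrite comp_lfunE !lfunE /=; apply/ffunP => S.
rewrite !ffunE; have [->|nbc] := eqVneq b c.
  by rewrite lfunE /= !ffunE; case: (_ == c).
rewrite zero_lfunE ffunE; case: ifP => // /eqP ->.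
by rewrite (negPf nbc).
Qed.

Lemma parity_partD : parity_part F n false + parity_part F n true = \1%VF.
Proof.
apply/lfunP => f; rewrite !lfun_simp /=; apply/ffunP => S; rewrite !ffunE.
by case: odd; rewrite /= ?addr0 ?add0r.
Qed.

(* D has parity b *)
Definition op_parity b (D : 'End(L)) : Prop := forall c,
  (D \o parity_part F n c)%VF = (parity_part F n (b (+) c) \o D)%VF.

Lemma op_part_homogeneous b b' D : op_parity b D ->
  op_part b' D = if b' == b then D else 0.
Proof.
move=> hD; rewrite /op_part.
under eq_bigr => c _ do rewrite -comp_lfunA hD comp_lfunA parity_partM.
have [->|nb] := eqVneq b' b; last first.
  rewrite big1 // => c _; rewrite (inj_eq (@addIb c)) (negPf nb); exact: comp_lfun0l.
under eq_bigr => c _ do rewrite eqxx.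
rewrite big_bool /= -comp_lfunDl -[RHS]comp_lfun1l -parity_partD.
by congr (_ \o _)%VF; case: b {hD} => //=; rewrite addrC.
Qed.

Lemma superbracket_homogeneous b c D D' : op_parity b D -> op_parity c D' ->
  superbracket D D' = (D \o D')%VF - (-1) ^+ (b && c) *: (D' \o D)%VF.
Proof.
move=> hD hD'; rewrite /superbracket (bigD1 b) //= (bigD1 c) //=.
rewrite (op_part_homogeneous _ hD) (op_part_homogeneous _ hD') !eqxx.
rewrite !big1 ?addr0 // => [b' /negPf nb|c' /negPf nc].
  rewrite big1 // => c' _; rewrite (op_part_homogeneous _ hD) nb.
  by rewrite comp_lfun0l comp_lfun0r scaler0 subr0.
rewrite (op_part_homogeneous _ hD') nc.
by rewrite comp_lfun0l comp_lfun0r scaler0 subr0.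
Qed.

Lemma vfieldE i f g : vfield F i f g = f * partial F i g.
Proof. by rewrite [vfield F i f]lfunE /= /vfield_fun comp_lfunE lfunE. Qed.

Lemma homogeneous_top f : f \in homogeneous F n n%:Z ->
  exists a, f = a *: top_monomial F n.
Proof.
move=> hf; suff : f \in <[top_monomial F n]>%VS by case/vlineP => a ->; exists a.
apply: subvP hf; apply/span_subvP => g /imageP[S + ->]; rewrite inE eqz_nat => cS.
rewrite (_ : S = setT) ?memv_line //.
by apply/eqP; rewrite eqEcard subsetT cardsT card_ord (eqP cS) /=.
Qed.

Lemma svect_comp_top : svect_comp F n (n%:Z - 1) = 0%VS.
Proof.
apply/eqP; rewrite -subv0; apply/subvP => D; rewrite memv_cap memv0 memv_ker.
case/andP => /memv_sumP[E hE ->] /eqP; rewrite lfunE /= /divergence_fun.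
have /fin_all_exists[a Ea] i : exists a, E i = vfield F i (a *: top_monomial F n).
  have /memv_imgP[f + ->] := hE i isT.
  by rewrite subrK => /homogeneous_top[a ->]; exists a.
have Egen j : (\sum_i E i) (generator F j) = a j *: top_monomial F n.
  rewrite sum_lfunE (bigD1 j) //= Ea vfieldE partial_generator eqxx mulr1.
  rewrite big1 ?addr0 // => i /negPf nij.
  by rewrite Ea vfieldE partial_generator nij mulr0.
move=> div0; apply/eqP/big1 => i _; rewrite Ea (_ : a i = 0) ?scale0r ?linear0 //.
move/ffunP/(_ (setT :\ i)): div0; rewrite sum_ffunE (bigD1 i) //= Egen.
rewrite linearZ /= parity_sign_monomial !linearZ /= partial_monomial inE.
rewrite big1 ?addr0 => [|j nij].
  rewrite !ffunE eqxx => /eqP; rewrite !scaler_eq0 !signr_eq0 oner_eq0 !orbF.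
  by move/eqP.
rewrite Egen linearZ /= parity_sign_monomial !linearZ /= partial_monomial inE.
rewrite !ffunE (_ : _ == _ = false) ?scaler0 //; apply/eqP => /setP/(_ i).
by rewrite !inE eqxx eq_sym nij.
Qed.

(* tsvect and svect have the same components of degrees 0 .. n - 2 *)
Lemma ms0_tsvect (b : {vspace 'End(L)}) :
  ms0 (tsvect F n) b = ms0 (svect F n) b.
Proof.
rewrite /ms0 /= /degrees_from_m1 -addn1 iotaD map_cat big_cat /=.
rewrite add0n big_cons big_nil addv0 svect_comp_top if_same addv0 !big_map.
congr (_ + _)%VS; apply: eq_bigr => k; rewrite /tsvect_comp.
by case: eqVneq => // ->.
Qed.

End GrassmannTheory.

(* Main.v *)
From HB Require Import structures.
Require Import Defs.
From mathcomp Require Import all_boot all_order all_fingroup all_algebra all_field.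
From mathcomp Require Import complex reals.
From mathcomp Require Import zify.

Set Implicit Arguments.
Unset Strict Implicit.
Unset Printing Implicit Defensive.

Import Order.TTheory GRing.Theory Num.Theory.
Local Open Scope ring_scope.

(** Let s be ms0, that is b plus all components of positive degree. It is
solvable because its derived series first runs through that of b, modulo the
positive part, and then moves up in degree until it leaves the finitely many
degrees. Let t be a graded solvable subalgebra containing s. Its component of
degree 0 is solvable and contains b, hence equals b; its positive components
are those of s. So t = s as soon as t has no component of degree -1, and this
is the point of the proof ([ms0_maximal_solvable]): a nonzero v of degree -1,
bracketed with the component g_1, which lies in t, produces a copy of a simple
Lie algebra of rank one inside t, whereas a solvable algebra contains no
nonzero perfect subspace ([perfect_not_solvable]).

For vect and svect, v is a nonzero constant field. Choose a linear w with
v(w) = 1 and an index p such that w is a multiple of xi_p; the linear forms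
l_i = xi_i - v(xi_i) w are killed by v, and v sends w l_i partial_j, which is
divergence-free for distinct i, j, p, to l_i partial_j. As n > 2 there are two
such indices, and l_i partial_j and l_j partial_i generate sl(2)
([svect_not_solvable]). For the deformed algebra, the additional summand
Xi v_0 of v = (1 + Xi) v_0 has degree n - 1, so its bracket with g_1 vanishes
for degree reasons ([superbracket_twist]) and the same sl(2) appears.

For h(0|n), v is H_u with u linear, and [H_u, H_(w a b)] = H_(a b) when
H_u(w) = 1 and a, b are linear and orthogonal to u. As n > 4 the hyperplane
orthogonal to u contains three orthogonal anisotropic vectors
([orthogonal_family]), even if u is isotropic, and the Hamiltonian fields of
their products span so(3) ([ham_not_solvable]).

The bracket relations are obtained from one principle: the component of degree
d of vect(0|n) is the space of all superderivations of degree d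
([vect_compP]); superderivations are closed under the superbracket and are
determined by their values on the generators. *)

(** * Parity and degree in the Grassmann algebra *)

Definition odd_degree (d : int) : bool := odd `|d|%N.

Lemma odd_degreeD c d : odd_degree (c + d) = odd_degree c (+) odd_degree d.
Proof. rewrite /odd_degree; lia. Qed.

Lemma odd_degree_nat (m : nat) : odd_degree m%:Z = odd m.
Proof. by []. Qed.

Section Grading.
Variables (F : fieldType) (n : nat).
Local Notation L := (grassmann F n).
Local Notation E := 'End(L).
Local Notation hom := (homogeneous F n).
Implicit Types (f g : L) (D : E) (S T U : {set 'I_n}) (d : int).

Lemma homogeneousP d f :
  reflect (forall S, #|S|%:Z != d -> f S = 0) (f \in hom d).
Proof.
apply: (iffP idP) => [/(@coord_span _ _ _ (in_tuple _)) -> S nS|f0].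
  rewrite sum_ffunE big1 // => i _; rewrite ffunE.
  have /imageP[A + ->] := mem_nth 0 (ltn_ord i).
  rewrite inE monomialE => /eqP cA; case: eqP => [SA|_]; last exact: scaler0.
  by rewrite SA cA eqxx in nS.
rewrite (grassmann_sum f) memv_suml // => S _.
have [cS|/f0->] := eqVneq #|S|%:Z d; last by rewrite scale0r mem0v.
by apply/memvZ/memv_span/imageP; exists S; rewrite // inE cS.
Qed.

Lemma homogeneous_monomial S : monomial F S \in hom #|S|%:Z.
Proof.
by apply/homogeneousP => T nT; rewrite monomialE; case: (T =P S) nT => // ->; rewrite eqxx.
Qed.

Lemma homogeneous_generator i : generator F i \in hom 1.
Proof. by have := homogeneous_monomial [set i]; rewrite cards1. Qed.

Lemma homogeneousM c d f g : f \in hom c -> g \in hom d -> f * g \in hom (c + d).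
Proof.
move=> /homogeneousP f0 /homogeneousP g0; apply/homogeneousP => U nU.
rewrite ffunE big1 // => S _; rewrite big1 // => T /eqP UE.
rewrite /monomial_sign; case: ifP => [dST|]; last by rewrite mul0r.
have [cS|/f0->] := eqVneq #|S|%:Z c; last by rewrite mul0r mulr0.
have [cT|/g0->] := eqVneq #|T|%:Z d; last by rewrite !mulr0.
by move: nU; rewrite -UE cardsU disjoint_setI0 // cards0 subn0 PoszD cS cT eqxx.
Qed.

Lemma homogeneous_out d f : f \in hom d -> (d < 0) || (n%:Z < d) -> f = 0.
Proof.
move=> /homogeneousP f0 dn; apply/ffunP => S; rewrite f0 ?ffunE //.
have := subset_leq_card (subsetT S); rewrite cardsT card_ord; move: dn; lia.
Qed.

Lemma homogeneous0 f : f \in hom 0 -> f = (f set0 : F) *: (1 : L).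
Proof.
move=> /homogeneousP f0; apply/ffunP => S; rewrite !ffunE.
have [->|nS] := eqVneq S set0; first by rewrite /GRing.scale /= mulr1.
by rewrite scaler0 f0 // eqz_nat cards_eq0.
Qed.

(** With this induction a statement that is linear in f reduces to monomials
without leaving the homogeneous component of f. *)
Lemma homogeneous_ind d (P : L -> Prop) :
  (forall a f g, P f -> P g -> P (a *: f + g)) -> P 0 ->
  (forall S, #|S|%:Z = d -> P (monomial F S)) -> forall f, f \in hom d -> P f.
Proof.
move=> Plin P0 Pmon f /homogeneousP f0; rewrite (grassmann_sum f).
apply: (big_ind P) => // [g h Pg Ph|S _]; first by rewrite -[g]scale1r; apply: Plin.
have [cS|/f0->] := eqVneq #|S|%:Z d; last by rewrite scale0r.
by rewrite -[_ *: _]addr0; apply: Plin => //; apply: Pmon.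
Qed.

(** The sign that an operator of parity b picks up when it passes f. *)
Definition psign b : E := if b then parity_sign F n else \1%VF.

Lemma psign_homogeneous b d f : f \in hom d ->
  psign b f = (-1) ^+ (b && odd_degree d) *: f.
Proof.
elim/homogeneous_ind => [a g h Eg Eh||S <-]; first 2 last.
- rewrite /psign; case: b; last by rewrite lfunE scale1r.
  by rewrite parity_sign_monomial /= signr_odd.
- by rewrite linearP /= Eg Eh scalerDr !scalerA mulrC.
- by rewrite linear0 scaler0.
Qed.

Lemma psignD b c f : psign b (psign c f) = psign (b (+) c) f.
Proof.
elim/grassmann_ind: f => [a f g IHf IHg|S]; first by rewrite !linearP /= IHf IHg.
have hS := homogeneous_monomial S.
rewrite !(psign_homogeneous _ hS) linearZ /= (psign_homogeneous _ hS) scalerA.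
by case: b; case: c; case: (odd_degree _); rewrite /= ?mulr1 ?mul1r ?mulN1r ?opprK.
Qed.

(** Each pair in S x T is an inversion for exactly one of the two orders, so the
exponents of the two signs add up to #|S| * #|T|. *)
Lemma monomial_signC S T :
  monomial_sign F S T = (-1) ^+ (odd #|S| && odd #|T|) * monomial_sign F T S.
Proof.
rewrite /monomial_sign disjoint_sym; case: ifP => dST; last by rewrite mulr0.
rewrite -oddM signr_odd -exprD.
have -> : (#|S| * #|T| = inversions S T + inversions T S)%N; last first.
  by rewrite -addnA exprD addnn -muln2 mulnC exprM sqrrN expr1n expr1n mulr1.
rewrite /inversions [X in (_ + X)%N]exchange_big -big_split /=.
rewrite -sum_nat_const; apply: eq_bigr => i iS; rewrite -big_split /=.
rewrite -sum1_card; apply: eq_bigr => j jT.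
have : i != j by apply: contraTneq iS => ->; rewrite (disjointFr dST).
by rewrite -val_eqE /=; case: ltngtP.
Qed.

Lemma grassmannC d f g : f \in hom d -> f * g = psign (odd_degree d) g * f.
Proof.
elim/homogeneous_ind => [a f1 f2 IH1 IH2||S <-].
- by rewrite mulrDl mulrDr -scalerAl -scalerAr IH1 IH2.
- by rewrite mul0r mulr0.
elim/grassmann_ind: g => [a g1 g2 IH1 IH2|T].
  by rewrite mulrDr -scalerAr !linearP /= IH1 IH2 mulrDl -scalerAl.
rewrite (psign_homogeneous _ (homogeneous_monomial T)) -scalerAl !monomialM.
by rewrite scalerA monomial_signC setUC.
Qed.

End Grading.

(** * The superbracket of operators *)

(** The cancellation of the mixed terms D f * D' g and D' f * D g in the Leibniz
rule for a bracket of superderivations. *)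
Lemma cancel_cross_terms (V : zmodType) (A X Y Z A' Z' : V) :
  A + X + (Y + Z) + (- (A' + Y) - (X + Z')) = A - A' + (Z - Z').
Proof.
rewrite [Y + Z]addrC [A + X + _]addrACA -opprD [X + Z']addrC [A' + Y + _]addrACA [Y + X]addrC.
by rewrite opprD [LHS]addrACA subrr addr0 opprD addrACA.
Qed.

Section Operators.
Variables (F : fieldType) (n : nat).
Local Notation L := (grassmann F n).
Local Notation E := 'End(L).
Local Notation hom := (homogeneous F n).
Implicit Types (f g : L) (D : E) (S T U : {set 'I_n}) (d : int).
Implicit Types (V W s t : {vspace E}).

Definition op_degree d D : Prop := forall m f, f \in hom m -> D f \in hom (m + d).

Lemma op_degree_psign b d D : op_degree d D ->
  forall f, D (psign F n b f) = (-1) ^+ (b && odd_degree d) *: psign F n b (D f).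
Proof.
move=> hD; elim/grassmann_ind => [a f g IHf IHg|S].
  by rewrite !linearP /= IHf IHg.
have hS := homogeneous_monomial F S.
rewrite (psign_homogeneous _ hS) (psign_homogeneous _ (hD _ _ hS)) linearZ /=.
by rewrite scalerA odd_degreeD; case: b; case: (odd_degree _); case: (odd_degree _);
   rewrite /= ?mulr1 ?mul1r ?mulN1r ?opprK.
Qed.

Lemma parity_part_homogeneous c d f : f \in hom d ->
  parity_part F n c f = if odd_degree d == c then f else 0.
Proof.
move=> /homogeneousP f0; rewrite lfunE /=; apply/ffunP => S; rewrite !ffunE.
have [<-|/f0 fS0] := eqVneq #|S|%:Z d; first by rewrite odd_degree_nat; case: ifP; rewrite ?ffunE.
by case: ifP; case: ifP => _ _; rewrite ?ffunE ?fS0.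
Qed.

Lemma op_degree_parity d D : op_degree d D -> op_parity (odd_degree d) D.
Proof.
move=> hD c; apply/lfunP; elim/grassmann_ind => [a f g IHf IHg|S].
  by rewrite !linearP /= IHf IHg.
rewrite !comp_lfunE; have hS := homogeneous_monomial F S.
rewrite (parity_part_homogeneous _ hS) (parity_part_homogeneous _ (hD _ _ hS)).
rewrite odd_degreeD addbC (inj_eq (@addbI _)).
by case: ifP => // _; rewrite linear0.
Qed.

(** For operators homogeneous in degree the parity is the degree modulo 2, and the
sum over parities in the bracket collapses to a single commutator. *)
Lemma superbracketE c d D D' : op_degree c D -> op_degree d D' ->
  forall f, superbracket D D' f =
    D (D' f) - (-1) ^+ (odd_degree c && odd_degree d) *: D' (D f).
Proof.
move=> /op_degree_parity hD /op_degree_parity hD' f.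
by rewrite (superbracket_homogeneous hD hD') !lfun_simp.
Qed.

Fact op_part_is_linear b : linear (@op_part F n b).
Proof.
move=> a D D'; rewrite /op_part scaler_sumr -big_split /=; apply: eq_bigr => c _.
apply/lfunP => f. rewrite !comp_lfunE !add_lfunE !scale_lfunE !comp_lfunE. by rewrite linearP.
Qed.

HB.instance Definition _ b := GRing.isSemilinear.Build F E E _
  (@op_part F n b) (GRing.semilinear_linear (op_part_is_linear b)).

Fact superbracket_is_linear D : linear (@superbracket F n D).
Proof.
move=> a D1 D2; rewrite /superbracket scaler_sumr -big_split /=.
apply: eq_bigr => b _; rewrite scaler_sumr -big_split /=; apply: eq_bigr => c _.
apply/lfunP => f; rewrite !linearP /=.
rewrite !(opp_lfunE, scale_lfunE, add_lfunE, comp_lfunE, linearP) /=.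
by rewrite scalerDr addrACA.
Qed.

HB.instance Definition _ D := GRing.isSemilinear.Build F E E _
  (@superbracket F n D) (GRing.semilinear_linear (superbracket_is_linear D)).

(** Carries the linearity of the bracket in its first argument. *)
Definition superbracketr D D' := superbracket D' D.

Fact superbracketr_is_linear D : linear (superbracketr D).
Proof.
move=> a D1 D2; rewrite /superbracketr /superbracket scaler_sumr -big_split /=.
apply: eq_bigr => b _; rewrite scaler_sumr -big_split /=; apply: eq_bigr => c _.
apply/lfunP => f; rewrite !linearP /=.
rewrite !(opp_lfunE, scale_lfunE, add_lfunE, comp_lfunE, linearP) /=.
by rewrite scalerDr addrACA.
Qed.

HB.instance Definition _ D := GRing.isSemilinear.Build F E E _
  (superbracketr D) (GRing.semilinear_linear (superbracketr_is_linear D)).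

Lemma mem_superbracketv V W D D' :
  D \in V -> D' \in W -> superbracket D D' \in superbracketv V W.
Proof.
move=> DV DW; rewrite (coord_vbasis DV) (coord_vbasis DW).
rewrite linear_sum memv_suml // => j _.
rewrite linearZ memvZ //= -/(superbracketr _ _) linear_sum memv_suml // => i _.
rewrite linearZ memvZ //=; apply/memv_span/allpairsP.
by exists ((vbasis V)`_i, (vbasis W)`_j); rewrite !mem_nth ?size_tuple.
Qed.

Lemma superbracketv_subP V W s :
  reflect (forall D D', D \in V -> D' \in W -> superbracket D D' \in s)
          (superbracketv V W <= s)%VS.
Proof.
apply: (iffP idP) => [VWs D D' DV DW|VWs].
  by apply: subvP VWs _ _; apply: mem_superbracketv.
apply/span_subvP => _ /allpairsP[[D D'] /= [DV DW ->]].
by apply: VWs; apply: vbasis_mem.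
Qed.

Lemma superbracketvS V V' W W' : (V <= V')%VS -> (W <= W')%VS ->
  (superbracketv V W <= superbracketv V' W')%VS.
Proof.
move=> VV' WW'; apply/superbracketv_subP => D D' DV DW.
by apply: mem_superbracketv; [apply: subvP DV | apply: subvP DW].
Qed.

Lemma superbracketvDl V V' W :
  superbracketv (V + V') W = (superbracketv V W + superbracketv V' W)%VS.
Proof.
apply/eqP; rewrite eqEsubv subv_add !superbracketvS ?addvSl ?addvSr // !andbT.
apply/superbracketv_subP => _ D' /memv_addP[D1 D1V [D2 D2V ->]] DW.
by rewrite -/(superbracketr _ _) linearD memv_add ?mem_superbracketv.
Qed.

Lemma superbracketvDr V W W' :
  superbracketv V (W + W') = (superbracketv V W + superbracketv V W')%VS.
Proof.
apply/eqP; rewrite eqEsubv subv_add !superbracketvS ?addvSl ?addvSr // !andbT.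
apply/superbracketv_subP => D _ DV /memv_addP[D1 D1V [D2 D2V ->]].
by rewrite linearD memv_add ?mem_superbracketv.
Qed.

Lemma derived_seriesS s t m : (s <= t)%VS ->
  (derived_series s m <= derived_series t m)%VS.
Proof. by move=> st; elim: m => //= m IHm; apply: superbracketvS. Qed.

Lemma lie_solvableS s t : (s <= t)%VS -> lie_solvable t -> lie_solvable s.
Proof.
move=> st [m tm]; exists m; apply/eqP; rewrite -subv0 -tm; exact: derived_seriesS.
Qed.

(** By induction the span of X lies in every term of the derived series of s,
because it lies in its own bracket with itself. *)
Lemma perfect_not_solvable (X : seq E) s : (forall D, D \in X -> D \in s) ->
  (forall D, D \in X -> D \in superbracketv <<X>> <<X>>) ->
  lie_solvable s -> forall D, D \in X -> D = 0.
Proof.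
move=> /span_subvP Xs /span_subvP XX [m sm] D DX; apply/eqP.
rewrite -memv0 -sm; apply: subvP (derived_seriesS m Xs) _ _.
suff /subvP : (<<X>> <= derived_series <<X>> m)%VS by apply; apply: memv_span.
elim: m {sm} => //= m IHm; apply: subv_trans XX _; exact: superbracketvS.
Qed.

End Operators.

(** * Homogeneous superderivations *)

Section Superderivations.
Variables (F : fieldType) (n : nat).
Local Notation L := (grassmann F n).
Local Notation E := 'End(L).
Local Notation hom := (homogeneous F n).
Local Notation psign := (psign F n).
Implicit Types (f g : L) (D : E) (S T U : {set 'I_n}) (d : int).

Definition superderivation b D : Prop :=
  forall f g, D (f * g) = D f * g + psign b f * D g.

Definition homogeneous_derivation d D : Prop :=
  op_degree d D /\ superderivation (odd_degree d) D.

Lemma superderivation1 b D : superderivation b D -> D 1 = 0.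
Proof.
move=> sD; have := sD 1 1; rewrite !mulr1.
have -> : psign b 1 = 1.
  have h1 := homogeneous_monomial F (set0 : {set 'I_n}).
  by rewrite (psign_homogeneous _ h1) cards0 andbF scale1r.
by rewrite mul1r => /eqP; rewrite -subr_eq0 opprD addNKr oppr_eq0 => /eqP.
Qed.

(** The kernel of a difference of two superderivations is a subalgebra. *)
Lemma superderivation_eq b D D' : superderivation b D -> superderivation b D' ->
  (forall i, D (generator F i) = D' (generator F i)) -> D = D'.
Proof.
move=> sD sD' DD'; apply/lfunP; elim/grassmann_ind => [a f g IHf IHg|S].
  by rewrite !linearP /= IHf IHg.
rewrite monomial_prod; elim/big_rec: _ => [|i f _ IH].
  by rewrite !(superderivation1 sD, superderivation1 sD').
by rewrite sD sD' IH DD'.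
Qed.

Lemma homogeneous_derivation_eq d D D' :
  homogeneous_derivation d D -> homogeneous_derivation d D' ->
  (forall i, D (generator F i) = D' (generator F i)) -> D = D'.
Proof. by move=> [_ sD] [_ sD']; apply: superderivation_eq sD sD'. Qed.

Lemma superbracket_derivation c d D D' :
  homogeneous_derivation c D -> homogeneous_derivation d D' ->
  homogeneous_derivation (c + d) (superbracket D D').
Proof.
move=> [hD sD] [hD' sD']; split=> [m f fm|f g].
  rewrite (superbracketE hD hD') rpredB ?rpredZ //.
    by rewrite [c + d]addrC addrA; apply/hD/hD'.
  by rewrite addrA; apply/hD'/hD.
rewrite !(superbracketE hD hD') sD' sD !linearD /= !sD !sD' odd_degreeD.
rewrite (op_degree_psign _ hD) (op_degree_psign _ hD').
rewrite !psignD [odd_degree d && _]andbC [odd_degree d (+) _]addbC.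
set e := (-1) ^+ _; have ee : e * e = 1 :> F by rewrite -expr2 sqrr_sign.
rewrite mulrBl mulrBr -!scalerAl -!scalerAr !scalerDr !scalerA ee scale1r.
exact: cancel_cross_terms.
Qed.

Lemma op_degreeB d D D' a : op_degree d D -> op_degree d D' -> op_degree d (a *: D + D').
Proof. by move=> hD hD' m f fm; rewrite !lfun_simp rpredD ?rpredZ //; [apply: hD | apply: hD']. Qed.

Lemma homogeneous_derivation_linear d D D' a :
  homogeneous_derivation d D -> homogeneous_derivation d D' ->
  homogeneous_derivation d (a *: D + D').
Proof.
move=> [hD sD] [hD' sD']; split; first exact: op_degreeB.
move=> f g; rewrite !lfun_simp sD sD' !mulrDl !mulrDr -!scalerAl -!scalerAr.
by rewrite scalerDr addrACA.
Qed.

Lemma homogeneous_derivation0 d : homogeneous_derivation d 0.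
Proof.
split=> [m f fm|f g]; first by rewrite lfunE mem0v.
by rewrite !lfunE /= mul0r mulr0 addr0.
Qed.

Lemma partial_degree (i : 'I_n) : @op_degree F n (-1) (partial F i).
Proof.
move=> m f /homogeneousP f0; apply/homogeneousP => S nS; rewrite lfunE /= ffunE.
have [//|iS] := boolP (i \in S); rewrite f0 ?scaler0 // cardsU1 iS /=.
by apply: contraNneq nS => <-; rewrite PoszD addrC addKr.
Qed.

Lemma vfield_derivation i d f :
  f \in hom (d + 1) -> homogeneous_derivation d (vfield F i f).
Proof.
move=> hf; split=> [m g gm|g h]; rewrite !vfieldE.
  by rewrite (_ : m + d = d + 1 + (m - 1)); [apply/homogeneousM/partial_degree | lia].
rewrite partial_superderivation mulrDr mulrA; congr (_ + _).
have -> : parity_sign F n g = psign true g by [].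
by rewrite mulrA (grassmannC _ hf) psignD odd_degreeD mulrA addbK.
Qed.

Lemma vfield_generator (i : 'I_n) f (j : 'I_n) : vfield F i f (generator F j) = f *+ (i == j).
Proof. by rewrite vfieldE partial_generator mulr_natr. Qed.

Lemma homogeneous_derivation_sum d D : homogeneous_derivation d D ->
  D = \sum_i vfield F i (D (generator F i)).
Proof.
move=> dD; have hi i : D (generator F i) \in hom (d + 1).
  by rewrite addrC; apply: dD.1; apply: homogeneous_generator.
apply: (homogeneous_derivation_eq dD) => [|j].
  apply: (big_ind (homogeneous_derivation d)) => [|D1 D2 h1 h2|i _].
  - exact: homogeneous_derivation0.
  - by rewrite -[D1]scale1r; apply: homogeneous_derivation_linear.
  - exact: vfield_derivation.
rewrite sum_lfunE (bigD1 j) //= vfield_generator eqxx mulr1n big1 ?addr0 //.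
by move=> i /negPf ij; rewrite vfield_generator ij.
Qed.

(** A superderivation D agrees with the sum of the D(xi_i) partial_i on the
generators, hence everywhere; membership in vect thus becomes a property that
is visibly stable under brackets. *)
Lemma vect_compP d D : D \in vect_comp F n d <-> homogeneous_derivation d D.
Proof.
split=> [/memv_sumP[X hX ->]|dD].
  apply: (big_ind (homogeneous_derivation d)) => [|D1 D2 h1 h2|i _].
  - exact: homogeneous_derivation0.
  - by rewrite -[D1]scale1r; apply: homogeneous_derivation_linear.
  - by have /memv_imgP[f hf ->] := hX i isT; apply: vfield_derivation.
rewrite (homogeneous_derivation_sum dD); apply: memv_sumr => i _.
by rewrite memv_img // addrC; apply: dD.1; apply: homogeneous_generator.
Qed.

(** A coefficient of a field of degree d has degree d + 1, which is at most n.
Several identities follow from this for degree reasons alone. *)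
Lemma vect_comp_out d : (d < -1) || (n%:Z <= d) -> vect_comp F n d = 0%VS.
Proof.
move=> dn; apply/eqP; rewrite -subv0; apply/subvP => D /vect_compP dD.
rewrite memv0 (homogeneous_derivation_sum dD) big1 // => i _.
rewrite (@homogeneous_out _ _ (1 + d) (D _)) ?linear0 //; last by move: dn; lia.
by apply: dD.1; apply: homogeneous_generator.
Qed.

End Superderivations.

(** * Maximality of a Borel subalgebra extended by the positive part *)

Section SequenceSums.
Variables (F : fieldType) (n : nat).
Local Notation E := 'End(grassmann F n).
Implicit Types (V : int -> {vspace E}) (W U : {vspace E}) (s : seq int).

Lemma subv_sum_seq s (P : pred int) V U :
  (forall d, d \in s -> P d -> (V d <= U)%VS) ->
  (\sum_(d <- s | P d) V d <= U)%VS.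
Proof.
move=> VU; rewrite big_seq_cond; apply: (big_ind (fun X => X <= U)%VS).
- exact: sub0v.
- by move=> X Y XU YU; rewrite subv_add XU.
- by move=> d /andP[ds Pd]; apply: VU.
Qed.

Lemma sumv_sup_seq d s (P : pred int) V : d \in s -> P d ->
  (V d <= \sum_(e <- s | P e) V e)%VS.
Proof. by move=> ds Pd; rewrite (big_rem d ds) /= Pd addvSl. Qed.

Lemma superbracketv_sumPl s (P : pred int) V W U :
  (forall d, d \in s -> P d -> (superbracketv (V d) W <= U)%VS) ->
  (superbracketv (\sum_(d <- s | P d) V d) W <= U)%VS.
Proof.
move=> VU; rewrite big_seq_cond.
apply: (big_ind (fun X => superbracketv X _ <= U)%VS) => [|X Y XU YU|d /andP[ds Pd]].
- apply/superbracketv_subP => D D'; rewrite memv0 => /eqP-> _.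
  by rewrite -/(superbracketr _ _) linear0 mem0v.
- by rewrite superbracketvDl subv_add XU.
- exact: VU.
Qed.

Lemma superbracketv_sumPr s (P : pred int) V W U :
  (forall d, d \in s -> P d -> (superbracketv W (V d) <= U)%VS) ->
  (superbracketv W (\sum_(d <- s | P d) V d) <= U)%VS.
Proof.
move=> VU; rewrite big_seq_cond.
apply: (big_ind (fun X => superbracketv _ X <= U)%VS) => [|X Y XU YU|d /andP[ds Pd]].
- by apply/superbracketv_subP => D D' _; rewrite memv0 => /eqP->; rewrite linear0 mem0v.
- by rewrite superbracketvDr subv_add XU.
- exact: VU.
Qed.

Lemma mem_degrees_from_m1 m d : (d \in degrees_from_m1 m) = (-1 <= d) && (d < m%:Z - 1).
Proof.
apply/mapP/idP => [[k + ->]|dm]; first by rewrite mem_iota; lia.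
by exists (absz (d + 1)); rewrite ?mem_iota; lia.
Qed.

End SequenceSums.

Section Maximality.
Variables (F : fieldType) (n : nat).
Local Notation E := 'End(grassmann F n).
Variables (g : graded_space F n) (m : nat) (b : {vspace E}).

Hypothesis gdegreesE : gdegrees g = degrees_from_m1 m.
Hypothesis m_gt2 : (2 < m)%N.
Hypothesis sub_gcomp : forall d : int, 0 <= d -> (gcomp g d <= g)%VS.
Hypothesis bracket_gcomp : forall c d : int, 0 <= c -> 0 <= d ->
  (superbracketv (gcomp g c) (gcomp g d) <= gcomp g (c + d))%VS.
Hypothesis gcomp_out : forall d : int, m%:Z - 1 <= d -> gcomp g d = 0%VS.
Hypothesis transitive_not_solvable : forall t v,
  lie_closed t -> lie_solvable t -> (gcomp g 1 <= t)%VS ->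
  v \in gcomp g (-1) -> v \in t -> v = 0.

Let tail (k : nat) : {vspace E} := (\sum_(d <- gdegrees g | k%:Z < d) gcomp g d)%VS.

Let sub_tail (k : nat) d : k%:Z < d -> (gcomp g d <= tail k)%VS.
Proof.
move=> kd; have [md|dm] := lerP (m%:Z - 1) d; first by rewrite gcomp_out ?sub0v.
by apply: sumv_sup_seq => //; rewrite gdegreesE mem_degrees_from_m1 dm; lia.
Qed.

Let bracket_tail (k : nat) : (superbracketv (tail k) (tail k) <= tail k.+1)%VS.
Proof.
apply: superbracketv_sumPl => c _ kc; apply: superbracketv_sumPr => d _ kd.
by apply: subv_trans (bracket_gcomp _ _) (sub_tail _); lia.
Qed.

Let tail_solvable : derived_series (tail 0) m = 0%VS.
Proof.
suff tail_k k : (derived_series (tail 0) k <= tail k)%VS.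
  apply/eqP; rewrite -subv0; apply: subv_trans (tail_k m) _.
  by apply: subv_sum_seq => d _ md; rewrite gcomp_out //; lia.
elim: k => [|k IHk] //=; apply: subv_trans (bracket_tail k).
exact: superbracketvS.
Qed.

Hypothesis b_maximal : maximal_solvable_subalgebra (gcomp g 0) b.

(** If t is graded, solvable and contains ms0, then its component of degree 0 is
b by maximality of b, its positive components are those of g, and its component
of degree -1 vanishes by the transitivity hypothesis. *)
Lemma ms0_maximal_solvable : maximal_solvable g (ms0 g b).
Proof.
have [[b_g0 b_closed [k b_k]] b_max] := b_maximal.
have ms0E : ms0 g b = (b + tail 0)%VS by [].
have tail0_bracket V W : (V <= gcomp g 0)%VS -> (W <= gcomp g 0)%VS ->
    (superbracketv (V + tail 0) (W + tail 0) <= superbracketv V W + tail 0)%VS.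
  move=> V0 W0; rewrite superbracketvDl !superbracketvDr.
  rewrite !subv_add addvSl /=; apply/and3P; split;
    apply: subv_trans (addvSr _ _).
  - apply: superbracketv_sumPr => d _ d0.
    apply: subv_trans (superbracketvS V0 (subvv _)) _.
    by apply: subv_trans (bracket_gcomp _ _) (sub_tail _); lia.
  - apply: superbracketv_sumPl => c _ c0.
    apply: subv_trans (superbracketvS (subvv _) W0) _.
    by apply: subv_trans (bracket_gcomp _ _) (sub_tail _); lia.
  - apply: superbracketv_sumPl => c _ c0; apply: superbracketv_sumPr => d _ d0.
    by apply: subv_trans (bracket_gcomp _ _) (sub_tail _); lia.
have derived_b j : (derived_series b j <= b)%VS.
  elim: j => //= j IHj; apply: subv_trans b_closed; exact: superbracketvS.
have derived_ms0 j : (derived_series (ms0 g b) j <= derived_series b j + tail 0)%VS.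
  elim: j => [|j IHj] //=.
  apply: subv_trans (superbracketvS IHj IHj) _.
  by apply: tail0_bracket; apply: subv_trans (derived_b j) b_g0.
have in_degrees d : -1 <= d -> d < m%:Z - 1 -> d \in gdegrees g.
  by move=> d1 dm; rewrite gdegreesE mem_degrees_from_m1 d1.
have b_ms0 : (b <= ms0 g b)%VS by rewrite ms0E addvSl.
have gcomp_ms0 d : 0 < d -> (gcomp g d <= ms0 g b)%VS.
  by move=> d0; rewrite ms0E; apply: subv_trans (sub_tail _) (addvSr _ _).
have ms0_bracket : lie_closed (ms0 g b).
  rewrite /lie_closed ms0E; apply: subv_trans (tail0_bracket _ _ b_g0 b_g0) _.
  exact: addvS b_closed (subvv _).
split.
  split=> //.
  - rewrite ms0E subv_add (subv_trans b_g0 (sub_gcomp _)) //=.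
    by apply: subv_sum_seq => d _ d0; apply: sub_gcomp; lia.
  - apply/eqP; rewrite eqEsubv; apply/andP; split; last first.
      by apply: subv_sum_seq => d _ _; apply: capvSl.
    rewrite {1}ms0E subv_add; apply/andP; split.
      apply: subv_trans (sumv_sup_seq _ (in_degrees 0 _ _) isT); rewrite ?subv_cap ?b_ms0 //; lia.
    apply: subv_sum_seq => d dg d0.
    apply: subv_trans (sumv_sup_seq _ dg isT).
    by rewrite subv_cap subvv gcomp_ms0.
  (* after k steps only the tail is left, which takes at most m more steps *)
  - exists (k + m)%N; rewrite addnC /derived_series iterD -!/(derived_series _ _).
    apply/eqP; rewrite -subv0 -tail_solvable; apply: derived_seriesS.
    by apply: subv_trans (derived_ms0 k) _; rewrite b_k add0v.
move=> t [t_g t_closed t_graded t_solvable] ms0_t.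
have t0_solvable : solvable_subalgebra (gcomp g 0) (t :&: gcomp g 0).
  split; first exact: capvSr.
  - rewrite /lie_closed subv_cap; apply/andP; split.
      by apply: subv_trans t_closed; apply: superbracketvS; apply: capvSl.
    apply: subv_trans (bracket_gcomp (lexx 0) (lexx 0)).
    by apply: superbracketvS; apply: capvSr.
  - exact: lie_solvableS (capvSl _ _) t_solvable.
have t0 : (t :&: gcomp g 0)%VS = b.
  by apply: b_max => //; rewrite subv_cap (subv_trans b_ms0 ms0_t).
apply/eqP; rewrite eqEsubv ms0_t andbT {1}t_graded.
apply: subv_sum_seq => d; rewrite gdegreesE mem_degrees_from_m1 => /andP[d1 _] _.
have [d_lt0|d_gt0|->] := ltrgtP d 0; last by rewrite t0.
  have -> : d = -1 by lia.
  apply/subvP => v; rewrite memv_cap => /andP[vt vg].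
  rewrite (transitive_not_solvable t_closed t_solvable _ vg vt) ?mem0v //.
  exact: subv_trans (gcomp_ms0 1 _) ms0_t.
by apply: subv_trans (capvSr _ _) (gcomp_ms0 _ _).
Qed.

End Maximality.

(** * Divergence-free vector fields *)

Section VectorFields.
Variables (F : fieldType) (n : nat).
Local Notation L := (grassmann F n).
Local Notation E := 'End(L).
Local Notation hom := (homogeneous F n).
Local Notation partial := (partial F).
Local Notation vfield := (vfield F).
Implicit Types (f g h : L) (D : E) (i j : 'I_n) (S T : {set 'I_n}) (d : int).

Lemma superbracket_vect c d : (superbracketv (vect_comp F n c) (vect_comp F n d) <=
  vect_comp F n (c + d))%VS.
Proof.
apply/superbracketv_subP => D D' /vect_compP hD /vect_compP hD'.
exact/vect_compP/superbracket_derivation.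
Qed.

Lemma vect_comp_sub d : (vect_comp F n d <= vect_total F n)%VS.
Proof.
apply/subv_sumP => i _; apply: (sumv_sup i) => //; apply: limgS; exact: subvf.
Qed.

Lemma partial_top i f : partial i f setT = 0.
Proof. by rewrite lfunE /= ffunE inE. Qed.

(** Integration by parts for the Berezin integral, which is the coefficient of the
top monomial: the integral of a derivative partial_i h is 0, and partial_i
applied to the sign-twisted f_i times g gives the two terms. *)
Lemma top_divergence d D g : homogeneous_derivation d D ->
  D g setT = - (divergence F n D * g) setT.
Proof.
move=> dD; apply/eqP; rewrite -addr_eq0; apply/eqP.
have -> : D g = \sum_i D (generator F i) * partial i g.
  rewrite {1}(homogeneous_derivation_sum dD) sum_lfunE.
  by apply: eq_bigr => i _; rewrite vfieldE.
rewrite lfunE /= /divergence_fun mulr_suml !sum_ffunE -big_split /=.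
apply: big1 => i _; have := partial_top i (psign F n true (D (generator F i)) * g).
rewrite partial_superderivation -/(psign F n true) psignD ffunE addrC.
by rewrite /psign /= id_lfunE.
Qed.

(** The coefficient of xi_S in h is, up to sign, the integral of the product of h
with the complementary monomial. *)
Lemma top_pairing_nondegenerate h : (forall g, (h * g) setT = 0) -> h = 0.
Proof.
move=> h0; apply/ffunP => S; rewrite ffunE.
have := h0 (monomial F (~: S)); rewrite {1}(grassmann_sum h) mulr_suml sum_ffunE.
rewrite (bigD1 S) //= big1 ?addr0 => [|T nTS].
  rewrite -scalerAl monomialM setUCr scalerA !ffunE eqxx /monomial_sign.
  rewrite -setI_eq0 setICr eqxx => /eqP; rewrite scaler_eq0 oner_eq0 orbF mulf_eq0.
  by rewrite signr_eq0 orbF => /eqP.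
rewrite -scalerAl monomialM !ffunE /monomial_sign -setI_eq0 -setDE setD_eq0.
case: ifP => TS; last by rewrite scale0r scaler0.
rewrite (_ : _ == _ = false) ?scaler0 //; apply: contraNF nTS => /eqP eT.
rewrite eqEsubset TS; apply/subsetP => i iS.
by have := in_setT i; rewrite eT !inE iS orbF.
Qed.

(** A field is divergence-free if and only if its values have Berezin integral 0.
In this form stability under the bracket is immediate and no formula for the
divergence of a bracket is needed. *)
Lemma divergence_free d D : homogeneous_derivation d D ->
  (D \in lker (divergence F n)) <-> (forall g, D g setT = 0).
Proof.
move=> dD; rewrite memv_ker; split=> [/eqP D0 g|D0].
  by rewrite (top_divergence _ dD) D0 mul0r ffunE oppr0.
apply/eqP/top_pairing_nondegenerate => g.
by have /eqP := D0 g; rewrite (top_divergence _ dD) oppr_eq0 => /eqP.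
Qed.

Lemma superbracket_svect c d : (superbracketv (svect_comp F n c) (svect_comp F n d) <=
  svect_comp F n (c + d))%VS.
Proof.
apply/superbracketv_subP => D D' /[!memv_cap] /andP[/vect_compP hD D0] /andP[/vect_compP hD' D'0].
have hDD' := superbracket_derivation hD hD'; apply/andP; split; first exact/vect_compP.
move: D0 D'0; rewrite (divergence_free hD) (divergence_free hD') => D0 D'0.
apply/(divergence_free hDD') => g; rewrite (superbracketE hD.1 hD'.1) !ffunE.
by rewrite D0 D'0 scaler0 oppr0 addr0.
Qed.

End VectorFields.

(** * A copy of sl(2) in the divergence-free fields *)

Section SpecialLinear.
Variables (F : fieldType) (n : nat).
Local Notation L := (grassmann F n).
Local Notation E := 'End(L).
Local Notation hom := (homogeneous F n).
Local Notation partial := (partial F).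
Local Notation vfield := (vfield F).
Local Notation xi := (generator F).
Implicit Types (f g h : L) (D v : E) (i j : 'I_n) (S T : {set 'I_n}) (d : int).

Lemma superderivation_const b D a : superderivation b D -> D (a *: 1) = 0.
Proof. by move=> sD; rewrite linearZ /= (superderivation1 sD) scaler0. Qed.

Lemma exists_two_other_indices (p : 'I_n) : (2 < n)%N ->
  exists i j, [/\ i != p, j != p & i != j].
Proof.
case: n p => [|[|[|m]]] // p _; exists (lift p ord0), (lift p (lift ord0 ord0)).
by rewrite ![_ == p]eq_sym !neq_lift (inj_eq lift_inj) neq_lift.
Qed.

(** Together with h = [e, f] the elements e and f span a perfect subspace, since 2
is invertible. *)
Lemma sl2_not_solvable (t : {vspace E}) (e f : E) : (2 : F) != 0 ->
  lie_closed t -> lie_solvable t -> e \in t -> f \in t ->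
  superbracket (superbracket e f) e = 2 *: e ->
  superbracket (superbracket e f) f = (- 2) *: f -> e = 0.
Proof.
move=> char2 t_closed t_solvable et ft; set h := superbracket e f => he hf.
have ht : h \in t by apply: (subvP t_closed); apply: mem_superbracketv.
pose X := [:: e; f; h].
have [eX fX hX] : [/\ e \in X, f \in X & h \in X] by rewrite !inE !eqxx !orbT.
have bX D D' : D \in X -> D' \in X -> superbracket D D' \in superbracketv <<X>> <<X>>.
  by move=> DX DX'; apply: mem_superbracketv; apply: memv_span.
have Xt D : D \in X -> D \in t by rewrite !inE => /or3P[]/eqP->.
have XX D : D \in X -> D \in superbracketv <<X>> <<X>>.
  rewrite !inE => /or3P[]/eqP->; last exact: bX.
  - have -> : e = 2^-1 *: superbracket h e by rewrite he scalerA mulVf ?scale1r.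
    by apply/memvZ/bX.
  - have -> : f = (- 2)^-1 *: superbracket h f.
      by rewrite hf scalerA mulVf ?scale1r ?oppr_eq0.
    by apply/memvZ/bX.
exact: (perfect_not_solvable Xt XX t_solvable).
Qed.

(** Inside the bracket of v with the divergence-free fields of degree 1 lie the
fields e_ij = l_i partial_j, where the linear forms l_i = xi_i - v(xi_i) w are
killed by v, and where i, j differ from an index p with v(xi_p) nonzero. They
multiply like matrix units, and a pair of distinct indices gives sl(2). *)
Lemma svect_not_solvable (t : {vspace E}) v : (2 < n)%N -> (2 : F) != 0 ->
  homogeneous_derivation (-1) v -> lie_closed t -> lie_solvable t ->
  (forall D, D \in svect_comp F n 1 -> superbracket v D \in t) -> v = 0.
Proof.
move=> n_gt2 char2 dv t_closed t_solvable vt; apply/eqP; apply: contraT => v0.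
have [c vxi] : exists c : 'I_n -> F, forall i, v (xi i) = c i *: 1.
  exists (fun i => v (xi i) set0) => i.
  apply: homogeneous0; rewrite -[0](addrN 1); apply: dv.1; exact: homogeneous_generator.
have [p cp0] : exists p, c p != 0.
  apply/existsP; apply: contraR v0 => /existsPn c0; apply/eqP.
  apply: (homogeneous_derivation_eq dv); first exact: homogeneous_derivation0.
  by move=> i; rewrite vxi (eqP (negbNE (c0 i))) scale0r lfunE.
(* w is normalized so that v w = 1; it only involves xi_p *)
have [w [hw vw dw]] : exists w,
    [/\ w \in hom 1, v w = 1 & forall j, j != p -> partial j w = 0].
  exists ((c p)^-1 *: xi p); split=> [||j jp].
  - by rewrite rpredZ ?homogeneous_generator.
  - by rewrite linearZ /= vxi scalerA mulVf // scale1r.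
  - by rewrite linearZ /= partial_generator (negPf jp) scaler0.
have [l [hl vl dl]] : exists l : 'I_n -> L,
    [/\ forall i, l i \in hom 1, forall i, v (l i) = 0 &
        forall i j, j != p -> partial j (l i) = (j == i)%:R].
  exists (fun i => xi i - c i *: w); split=> [i|i|i j jp].
  - by rewrite rpredB ?rpredZ ?homogeneous_generator.
  - by rewrite linearB linearZ /= vw vxi subrr.
  - by rewrite linearB linearZ /= dw // scaler0 subr0 partial_generator.
have [e [de exi el]] : exists e : 'I_n -> 'I_n -> E,
    [/\ forall i j, homogeneous_derivation 0 (e i j),
        forall i j k, e i j (xi k) = if j == k then l i else 0 &
        forall i j k, j != p -> e i j (l k) = if j == k then l i else 0].
  exists (fun i j => vfield j (l i)); split=> [i j|i j k|i j k jp].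
  - exact: vfield_derivation.
  - by rewrite vfield_generator; case: eqP.
  - by rewrite vfieldE dl // mulr_natr; case: eqP.
(* e_ij = [v, w l_i partial_j], and partial_j kills both w and l_i *)
have et i j : i != p -> j != p -> i != j -> e i j \in t.
  move=> ip jp ij; have hwl : w * l i \in hom (1 + 1) by apply: homogeneousM.
  have [D [dD Dxi]] : exists D, homogeneous_derivation 1 D /\
      forall k, D (xi k) = if j == k then w * l i else 0.
    exists (vfield j (w * l i)); split; first exact: vfield_derivation.
    by move=> k; rewrite vfield_generator; case: eqP.
  have -> : e i j = superbracket v D.
    apply: (homogeneous_derivation_eq (de i j) (superbracket_derivation dv dD)) => k.
    rewrite (superbracketE dv.1 dD.1) vxi (superderivation_const _ dD.2).
    rewrite scaler0 subr0 exi Dxi; case: eqP => _; last by rewrite linear0.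
    by rewrite dv.2 vw vl mulr0 addr0 mul1r.
  apply: vt; rewrite memv_cap; apply/andP; split; first exact/vect_compP.
  rewrite memv_ker lfunE /= /divergence_fun big1 // => k _.
  rewrite Dxi; have [<-|_] := eqVneq j k; last by rewrite !linear0.
  rewrite -/(psign F n true) (psign_homogeneous _ hwl) linearZ /=.
  by rewrite partial_superderivation dw // dl // mul0r eq_sym (negPf ij) mulr0 addr0 scaler0.
have [i [j [ip jp ij]]] := exists_two_other_indices p n_gt2.
have ji : j != i by rewrite eq_sym.
have [h hE] : exists h : E, h = superbracket (e i j) (e j i) by eexists.
have dh : homogeneous_derivation 0 h.
  by rewrite hE; apply: (superbracket_derivation (de i j) (de j i)).
have hcomp x : h x = e i j (e j i x) - e j i (e i j x).
  by rewrite hE (superbracketE (de i j).1 (de j i).1) scale1r.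
have hl_ a : h (l a) = (if i == a then l i else 0) - (if j == a then l j else 0).
  rewrite hcomp !el //; case: (i == a); case: (j == a);
  by rewrite ?linear0 ?el // ?eqxx.
have hxi k : h (xi k) = (if i == k then l i else 0) - (if j == k then l j else 0).
  rewrite hcomp !exi; case: (i == k); case: (j == k);
  by rewrite ?linear0 ?el // ?eqxx.
have eB a b x y : e a b (x - y) = e a b x - e a b y by apply: linearB.
have dZ a D : homogeneous_derivation 0 D -> homogeneous_derivation 0 (a *: D).
  move=> dD; rewrite -[_ *: _]addr0; apply: homogeneous_derivation_linear => //.
  exact: homogeneous_derivation0.
have e0 : e i j = 0.
  apply: (@sl2_not_solvable t _ (e j i)) => //; [exact: et|exact: et| |]; rewrite -hE.
  - apply: (homogeneous_derivation_eq (superbracket_derivation dh (de i j)) (dZ _ _ (de i j))) => k.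
    rewrite (superbracketE dh.1 (de i j).1) scale1r scale_lfunE !exi hxi eB.
    case: eqVneq => [<-|_].
      by rewrite (negPf ij) linear0 sub0r el // eqxx opprK hl_ eqxx (negPf ji) subr0 scaler_nat.
    by case: eqP => _; rewrite ?el // ?(negPf ji) !(linear0, scaler0, subr0, addr0).
  - apply: (homogeneous_derivation_eq (superbracket_derivation dh (de j i)) (dZ _ _ (de j i))) => k.
    rewrite (superbracketE dh.1 (de j i).1) scale1r scale_lfunE !exi hxi eB.
    case: eqVneq => [<-|_].
      by rewrite (negPf ji) linear0 subr0 el // eqxx hl_ eqxx (negPf ij) sub0r -opprD scaleNr scaler_nat.
    by case: eqP => _; rewrite ?el // ?(negPf ij) !(linear0, scaler0, subr0, addr0).
have := dl i i ip; have := exi i j j; rewrite e0 eqxx zero_lfunE => <-.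
by rewrite eqxx linear0 => /eqP; rewrite eq_sym oner_eq0.
Qed.

End SpecialLinear.

(** * Orthogonal anisotropic vectors in a hyperplane *)

Section OrthogonalFamily.
Variables (F : fieldType) (n : nat) (B : 'M[F]_n).
Hypotheses (char2 : (2 : F) != 0) (B_sym : B^T = B) (B_unit : B \in unitmx).

Lemma gram_row p q (Y : 'M[F]_(p, n)) (Z : 'M[F]_(q, n)) i j :
  (row i Y *m B *m (row j Z)^T) 0 0 = (Y *m B *m Z^T) i j.
Proof.
rewrite -row_mul tr_row [LHS]mxE [RHS]mxE; apply: eq_bigr => k _.
by congr (_ * _); rewrite mxE.
Qed.

(** Polarization: if all rows of W are isotropic and some two of them are not
orthogonal, their sum is anisotropic. *)
Lemma exists_anisotropic m (W : 'M[F]_(m, n)) : W *m B *m W^T != 0 ->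
  exists2 a : 'rV[F]_n, (a <= W)%MS & (a *m B *m a^T) 0 0 != 0.
Proof.
pose G := W *m B *m W^T; move=> nG.
have GE i j : (row i W *m B *m (row j W)^T) 0 0 = G i j by apply: gram_row.
have GT : G^T = G by rewrite /G !trmx_mul trmxK B_sym mulmxA.
have Gsym i j : G j i = G i j by rewrite -[in LHS]GT mxE.
have [i|G0] := pickP (fun i => G i i != 0).
  by move=> Gii; exists (row i W); rewrite ?row_sub ?GE.
have [ij|Gij0] := pickP (fun ij => G ij.1 ij.2 != 0); last first.
  by case/eqP: nG; apply/matrixP => i j; rewrite [RHS]mxE; apply/eqP/negbFE/(Gij0 (i, j)).
case: ij => i j /= Gij; exists (row i W + row j W).
  by rewrite addmx_sub ?row_sub.
rewrite linearD /= !(mulmxDl, mulmxDr) ![(_ + _ : 'M__) 0 0]mxE !GE.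
rewrite (eqP (negbFE (G0 i))) (eqP (negbFE (G0 j))) add0r addr0 Gsym.
by rewrite -mulr2n -mulr_natl mulf_neq0.
Qed.

(** Given k such vectors, the orthogonal W of u and of these vectors has dimension
at least 2. If W were totally isotropic, it would lie in its own orthogonal, the
span of u and of the k vectors; being orthogonal to the k anisotropic vectors,
it would then lie in the line of u. So W contains a further anisotropic vector.
The vector u itself may be isotropic. *)
Lemma orthogonal_family (u : 'rV[F]_n) k : (k + 2 <= n)%N ->
  exists (A : 'M[F]_(k, n)) (d : 'rV[F]_k),
    [/\ u *m B *m A^T = 0, A *m B *m A^T = diag_mx d & forall i, d 0 i != 0].
Proof.
elim: k => [|k IHk] k_lt.
  by exists 0, 0; split=> [||[]//]; apply/matrixP => i [].
have [|A [d [uA AA d0]]] := IHk; first by apply: leq_trans k_lt.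
pose M := col_mx u A.
have rankM : \rank (B *m M^T) = \rank M by rewrite eqmxMfull ?mxrank_tr ?row_full_unit.
have [W rankW WM] : exists2 W : 'M[F]_n, \rank W = (n - \rank M)%N & W *m B *m M^T = 0.
  by exists (kermx (B *m M^T)); rewrite ?mxrank_ker ?rankM // -mulmxA mulmx_ker.
have [a aW a0] : exists2 a : 'rV[F]_n, (a <= W)%MS & (a *m B *m a^T) 0 0 != 0.
  apply: exists_anisotropic; apply/negP => /eqP WW.
  (* by dimension, the orthogonal of W is the row space of M *)
  have MW : (W <= M)%MS.
    have sM : (M <= kermx (B *m W^T))%MS.
      apply/sub_kermxP; rewrite mulmxA; apply: trmx_inj.
      by rewrite !trmx_mul trmxK B_sym mulmxA WM trmx0.
    have sW : (W <= kermx (B *m W^T))%MS by apply/sub_kermxP; rewrite mulmxA.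
    apply: submx_trans sW _; rewrite -(mxrank_leqif_sup sM).
    rewrite mxrank_ker eqmxMfull ?row_full_unit // mxrank_tr rankW.
    by rewrite subKn // rank_leq_col.
  have /submxP[X WX] := MW.
  have rX : rsubmx X = 0.
    have : W *m B *m A^T = 0.
      by have := WM; rewrite tr_col_mx mul_mx_row => /eqP; rewrite row_mx_eq0 => /andP[_ /eqP].
    rewrite WX -{1}[X]hsubmxK mul_row_col !mulmxDl -!mulmxA !(mulmxA u) uA mulmx0 add0r.
    rewrite (mulmxA A) AA => /matrixP XA; apply/matrixP => i j.
    have /eqP := XA i j; rewrite mul_mx_diag !mxE mulf_eq0 (negPf (d0 j)) orbF => /eqP.
    by [].
  have : (\rank W <= 1)%N.
    rewrite WX -[X]hsubmxK rX mul_row_col mul0mx addr0.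
    by apply: leq_trans (mxrankM_maxr _ _) (rank_leq_row _).
  rewrite rankW; have := rank_leq_row M; lia.
have aM : a *m B *m M^T = 0.
  by have /submxP[X ->] := aW; rewrite -!mulmxA [X in _ *m X]mulmxA WM mulmx0.
have /andP[/eqP au /eqP aA] : (a *m B *m u^T == 0) && (a *m B *m A^T == 0).
  by rewrite -row_mx_eq0 -mul_mx_row -tr_col_mx aM.
have swap p q (Y : 'M[F]_(p, n)) (Z : 'M[F]_(q, n)) : Y *m B *m Z^T = 0 -> Z *m B *m Y^T = 0.
  by move=> YZ; apply: trmx_inj; rewrite !trmx_mul trmxK B_sym mulmxA YZ trmx0.
rewrite -[k.+1]/(1 + k)%N; exists (col_mx a A), (row_mx (a *m B *m a^T) d); split.
- by rewrite tr_col_mx mul_mx_row (swap _ _ _ _ au) uA row_mx0.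
- rewrite tr_col_mx mul_col_mx mul_col_row aA (swap _ _ _ _ aA) AA diag_mx_row.
  by congr block_mx; apply/matrixP => i j; rewrite !ord1 [RHS]mxE eqxx.
- by move=> i; rewrite mxE; case: splitP => j _; rewrite ?ord1.
Qed.

End OrthogonalFamily.

(** * Hamiltonian vector fields *)

Section HamiltonianFields.
Variables (F : fieldType) (n : nat) (s : 'I_n -> 'I_n).
Hypothesis sK : involutive s.
Local Notation L := (grassmann F n).
Local Notation E := 'End(L).
Local Notation hom := (homogeneous F n).
Local Notation partial := (partial F).
Local Notation vfield := (vfield F).
Local Notation psign := (psign F n).
Local Notation xi := (generator F).
Implicit Types (f g h : L) (D v : E) (i j : 'I_n) (S T : {set 'I_n}) (d : int).

(** The Hamiltonian field of f for the symplectic structure in which the generator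
of index i is paired with that of index s i. *)
Definition ham f : E := \sum_i vfield (s i) (partial i (psign true f)).

Fact ham_is_linear : linear ham.
Proof.
move=> a f g; rewrite /ham scaler_sumr -big_split /=.
by apply: eq_bigr => i _; rewrite !linearP.
Qed.

HB.instance Definition _ := GRing.isSemilinear.Build F L E _
  ham (GRing.semilinear_linear ham_is_linear).

Lemma partial_derivation i : homogeneous_derivation (-1) (partial i).
Proof. by split; [apply: partial_degree | apply: partial_superderivation]. Qed.

(** The superbracket of two partial derivatives is a superderivation of degree -2,
hence 0. *)
Lemma partialC i j f : partial i (partial j f) = - partial j (partial i f).
Proof.
have := superbracket_derivation (partial_derivation i) (partial_derivation j).
move/vect_compP; rewrite vect_comp_out // memv0 => /eqP/lfunP/(_ f).
rewrite (superbracketE (@partial_degree F n i) (@partial_degree F n j)) zero_lfunE.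
by rewrite scaleN1r opprK => /eqP; rewrite addr_eq0 => /eqP.
Qed.

Lemma ham_generator f i : ham f (xi (s i)) = partial i (psign true f).
Proof.
rewrite /ham sum_lfunE (bigD1 i) //= vfield_generator eqxx mulr1n.
by rewrite big1 ?addr0 // => j /negPf ij; rewrite vfield_generator (inj_eq (inv_inj sK)) ij.
Qed.

Lemma hamE m f g : f \in hom m ->
  ham f g = (-1) ^+ (odd_degree m) *: \sum_i partial i f * partial (s i) g.
Proof.
move=> hf; rewrite /ham sum_lfunE scaler_sumr; apply: eq_bigr => i _.
by rewrite vfieldE (psign_homogeneous _ hf) linearZ -scalerAl.
Qed.

Lemma ham_derivation m f : f \in hom m -> homogeneous_derivation (m - 2) (ham f).
Proof.
move=> hf; apply/vect_compP; apply: memv_suml => i _; apply/vect_compP.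
apply: vfield_derivation; rewrite (_ : m - 2 + 1 = m - 1); last by lia.
by apply: partial_degree; rewrite (psign_homogeneous _ hf) rpredZ.
Qed.

Lemma odd_degreeB2 m : odd_degree (m - 2) = odd_degree m.
Proof. by rewrite odd_degreeD addbF. Qed.

(** The map f |-> H_f turns the Poisson bracket H_f(g) into the superbracket. Both
sides are superderivations; on xi_(s j) they compare two sums over i, which
agree term by term once i is replaced by s i in the sum coming from H_g. *)
Lemma superbracket_ham a b f g : f \in hom a -> g \in hom b ->
  superbracket (ham f) (ham g) = ham (ham f g).
Proof.
move=> hf hg; have [df dg] := (ham_derivation hf, ham_derivation hg).
have hfg : ham f g \in hom (b + (a - 2)) by apply: df.1.
apply: (homogeneous_derivation_eq (superbracket_derivation df dg)) => [|j'].
  by rewrite (_ : a - 2 + (b - 2) = b + (a - 2) - 2); [apply: ham_derivation | lia].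
rewrite -(sK j'); move: (s j') => j; rewrite (superbracketE df.1 dg.1) !ham_generator.
rewrite (psign_homogeneous _ hf) (psign_homogeneous _ hg) (psign_homogeneous _ hfg).
have lZ D c x : D (c *: x) = c *: D x by apply: linearZ.
rewrite !lZ !(hamE _ hf) !(hamE _ hg) lZ [partial j (\sum_i _)]linear_sum /=.
rewrite [X in _ - _ *: (_ *: (_ *: X))](reindex_inj (inv_inj sK)) /= !scaler_sumr -sumrB.
apply: eq_bigr => i _; rewrite sK partial_superderivation !odd_degreeB2 odd_degreeD odd_degreeB2.
have hpf : partial i f \in hom (a - 1) by apply: partial_degree.
have hppf : partial i (partial j f) \in hom (a - 1 - 1).
  by apply: partial_degree; apply: partial_degree.
have hpg : partial (s i) g \in hom (b - 1) by apply: partial_degree.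
rewrite -/(psign true) (psign_homogeneous _ hpf) (partialC j (s i)) (partialC j i) mulNr (grassmannC _ hppf).
rewrite (psign_homogeneous _ hpg) mulrN -!scalerAl.
set P := _ * partial (s i) (partial j g); set Q := _ * partial i (partial j f).
rewrite ![odd_degree (_ - 1)]odd_degreeD /=.
case: (odd_degree a); case: (odd_degree b); rewrite /= ?expr0 ?expr1 ?scale1r ?scaleN1r ?opprK;
  rewrite ?scale1r ?scaleN1r ?opprK ?opprD ?opprK //. all: by rewrite addrC.
Qed.

Definition lcomb (x : 'rV[F]_n) : L := \sum_i x 0 i *: xi i.

Lemma lcomb_homogeneous x : lcomb x \in hom 1.
Proof. by apply: memv_suml => i _; rewrite rpredZ ?homogeneous_generator. Qed.

Lemma partial_lcomb i x : partial i (lcomb x) = x 0 i *: 1.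
Proof.
rewrite linear_sum (bigD1 i) //= linearZ /= partial_generator eqxx big1 ?addr0 // => j.
by rewrite eq_sym => /negPf ij; rewrite linearZ /= partial_generator ij scaler0.
Qed.

Lemma homogeneous1_lcomb f : f \in hom 1 -> exists x, f = lcomb x.
Proof.
elim/homogeneous_ind => [a g h [x ->] [y ->]||S [/eqP/cards1P[i ->]]].
- exists (a *: x + y); rewrite /lcomb scaler_sumr -big_split /=; apply: eq_bigr => i _.
  by rewrite !mxE scalerDl scalerA.
- by exists 0; rewrite /lcomb big1 // => i _; rewrite mxE scale0r.
- exists (delta_mx 0 i); rewrite /lcomb (bigD1 i) //= mxE !eqxx scale1r big1 ?addr0 // => j.
  by move/negPf => ji; rewrite mxE ji andbF scale0r.
Qed.

Definition dual_form_mx : 'M[F]_n := perm_mx (perm (inv_inj sK)).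

(** The bilinear form on linear elements given by the Poisson bracket, up to
sign. *)
Definition dual_form (x y : 'rV[F]_n) : F := \sum_i x 0 i * y 0 (s i).

Lemma dual_form_mxE x y : (x *m dual_form_mx *m y^T) 0 0 = dual_form x y.
Proof.
rewrite -mulmxA -row_permE mxE; apply: eq_bigr => i _.
by rewrite !mxE permE.
Qed.

Lemma dual_form_mx_sym : dual_form_mx^T = dual_form_mx.
Proof.
rewrite /dual_form_mx tr_perm_mx; congr perm_mx; apply/permP => i.
by apply: (@perm_inj _ (perm (inv_inj sK))); rewrite permKV !permE sK.
Qed.

Lemma ham_lcomb x y : ham (lcomb x) (lcomb y) = - dual_form x y *: 1.
Proof.
rewrite (hamE _ (lcomb_homogeneous x)) scaleN1r scaleNr /dual_form scaler_suml.
congr (- _); apply: eq_bigr => i _; rewrite !partial_lcomb.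
by rewrite -scalerAl mul1r scalerA.
Qed.

(** The Hamiltonian field of a product of two linear elements acts on linear
elements as an infinitesimal rotation in their plane. *)
Lemma ham_lcomb2 a b y : ham (lcomb a * lcomb b) (lcomb y) =
  dual_form a y *: lcomb b - dual_form b y *: lcomb a.
Proof.
have [ha hb] := (lcomb_homogeneous a, lcomb_homogeneous b).
rewrite (hamE _ (homogeneousM ha hb)) scale1r /dual_form !scaler_suml -sumrB.
apply: eq_bigr => i _; rewrite partial_superderivation -/(psign true).
rewrite (psign_homogeneous _ ha) !partial_lcomb scaleN1r mulrDl -!scalerAl -!scalerAr.
rewrite mul1r !mulr1 scalerA.
by rewrite scalerA scalerN [y 0 _ * _]mulrC.
Qed.

Lemma lcomb_anticomm a b : lcomb a * lcomb b = - (lcomb b * lcomb a).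
Proof.
rewrite (grassmannC _ (lcomb_homogeneous a)) (psign_homogeneous _ (lcomb_homogeneous b)).
by rewrite scaleN1r mulNr.
Qed.

Lemma so3_bracket a b c : dual_form a b = 0 -> dual_form b c = 0 -> dual_form a c = 0 ->
  superbracket (ham (lcomb a * lcomb b)) (ham (lcomb b * lcomb c)) =
  dual_form b b *: ham (lcomb c * lcomb a).
Proof.
move=> ab bc ac; have hM x y := homogeneousM (lcomb_homogeneous x) (lcomb_homogeneous y).
rewrite (superbracket_ham (hM a b) (hM b c)) -linearZ /=; congr ham.
rewrite (ham_derivation (hM a b)).2 !ham_lcomb2 ab bc ac !scale0r !subr0 mulr0 addr0.
by rewrite sub0r mulNr -scalerAl lcomb_anticomm scalerN.
Qed.

End HamiltonianFields.

(** * A copy of so(3) in the Hamiltonian fields *)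

Section Orthogonal.
Variables (F : fieldType) (n : nat) (s : 'I_n -> 'I_n).
Hypothesis sK : involutive s.
Local Notation E := 'End(grassmann F n).
Local Notation hom := (homogeneous F n).
Implicit Types (t : {vspace E}).

(** Up to nonzero scalars these are the cyclic relations of so(3). *)
Lemma so3_not_solvable t (x y z : E) (p q r : F) :
  lie_closed t -> lie_solvable t -> x \in t -> y \in t -> z \in t ->
  p != 0 -> q != 0 -> r != 0 ->
  superbracket x y = p *: z -> superbracket y z = q *: x ->
  superbracket z x = r *: y -> x = 0.
Proof.
move=> t_closed t_solvable xt yt zt p0 q0 r0 xy yz zx.
pose X := [:: x; y; z].
have [xX yX zX] : [/\ x \in X, y \in X & z \in X] by rewrite !inE !eqxx !orbT.
have Xt D : D \in X -> D \in t by rewrite !inE => /or3P[]/eqP->.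
have scaled (a b c : E) k : k != 0 -> a \in X -> b \in X ->
    superbracket a b = k *: c -> c \in superbracketv <<X>> <<X>>.
  move=> k0 aX bX ab; have -> : c = k^-1 *: superbracket a b.
    by rewrite ab scalerA mulVf ?scale1r.
  by apply/memvZ/mem_superbracketv; apply: memv_span.
have XX D : D \in X -> D \in superbracketv <<X>> <<X>>.
  by rewrite !inE => /or3P[]/eqP->; [apply: scaled yz | apply: scaled zx | apply: scaled xy].
exact: (perfect_not_solvable Xt XX t_solvable).
Qed.

(** With H_u(w) = 1 and a, b orthogonal to u, the Leibniz rule gives
H_u(w a b) = a b, so t contains the Hamiltonian fields of the products of any
two of three orthogonal anisotropic vectors that are orthogonal to u. *)
Lemma ham_not_solvable t u : (4 < n)%N -> (2 : F) != 0 -> u \in hom 1 ->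
  lie_closed t -> lie_solvable t ->
  (forall f, f \in hom 3 -> superbracket (ham s u) (ham s f) \in t) -> ham s u = 0.
Proof.
move=> n_gt4 char2 hu t_closed t_solvable ut; have [x Ex] := homogeneous1_lcomb hu; subst u.
have [->|x0] := eqVneq x 0.
  by rewrite (_ : lcomb 0 = 0) ?linear0 // /lcomb big1 // => i _; rewrite mxE scale0r.
have [w Ew] : exists w, ham s (lcomb x) (lcomb w) = 1.
  have [i xi0] : exists i, x 0 i != 0 by apply/rV0Pn.
  exists (- (x 0 i)^-1 *: delta_mx 0 (s i)).
  rewrite ham_lcomb // /dual_form (bigD1 i) //= big1 ?addr0 => [|j /negPf ji].
    by rewrite !mxE !eqxx mulr1 mulrN opprK divff ?scale1r.
  by rewrite !mxE (inj_eq (inv_inj sK)) ji !mulr0.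
have [A [d [xA AA d0]]] := @orthogonal_family F n (dual_form_mx F sK) char2
  (dual_form_mx_sym _ sK) (unitmx_perm _ _) x 3 n_gt4.
pose a i := row i A.
have formA i j : dual_form s (a i) (a j) = d 0 i *+ (i == j).
  by rewrite -(dual_form_mxE sK) gram_row AA mxE.
have formx i : dual_form s x (a i) = 0.
  by rewrite -(dual_form_mxE sK) -[x in LHS](row_id 0) gram_row xA mxE.
have rot i j : i != j -> ham s (lcomb (a i) * lcomb (a j)) \in t.
  move=> ij; have hM (p q : 'rV[F]_n) := homogeneousM (lcomb_homogeneous p) (lcomb_homogeneous q).
  have hw := homogeneousM (lcomb_homogeneous w) (hM (a i) (a j)).
  have dx := ham_derivation s (lcomb_homogeneous x).
  rewrite (_ : _ * _ = ham s (lcomb x) (lcomb w * (lcomb (a i) * lcomb (a j)))).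
    by rewrite -(superbracket_ham sK (lcomb_homogeneous x) hw); apply: ut.
  by rewrite dx.2 Ew mul1r dx.2 !ham_lcomb !formx oppr0 scale0r mul0r mulr0 addr0 mulr0 addr0.
have e0 : ham s (lcomb (a 0) * lcomb (a 1)) = 0.
  have off i j : i != j -> dual_form s (a i) (a j) = 0 by rewrite formA => /negPf->.
  have diag i : dual_form s (a i) (a i) = d 0 i by rewrite formA eqxx.
  by apply: (so3_not_solvable t_closed t_solvable (rot 0 1 isT) (rot 1 2 isT)
    (rot 2 0 isT) (d0 1) (d0 2) (d0 0)); rewrite -diag; apply: so3_bracket; rewrite ?off.
(* if H_(a_0 a_1) were 0, its value on a_1 would give a_0 = 0 *)
have := ham_lcomb2 s (a 0) (a 1) (a 1); rewrite e0 !formA mulr0n scale0r sub0r zero_lfunE.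
move/(congr1 (ham s (lcomb (a 0)))); rewrite linear0 linearN linearZ /= ham_lcomb formA.
move/eqP; rewrite eq_sym oppr_eq0 !scaler_eq0 oppr_eq0 oner_eq0 orbF eqxx !mulr1n.
by rewrite (negPf (d0 _)) (negPf (d0 _)).
Qed.

End Orthogonal.

(** * The four series of vector fields *)

Section Algebras.
Variable (F : fieldType).
Hypothesis char2 : (2 : F) != 0.

Lemma svect_comp_sub n d : (svect_comp F n d <= vect_comp F n d)%VS.
Proof. exact: capvSl. Qed.

Lemma ms0_vect_maximal n (b : {vspace 'End(grassmann F n)}) : (2 < n)%N ->
  maximal_solvable_subalgebra (gcomp (vect F n) 0) b ->
  maximal_solvable (vect F n) (ms0 (vect F n) b).
Proof.
move=> n_gt2; apply: (@ms0_maximal_solvable F n (vect F n) n.+1) => //=; first by lia.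
- by move=> d _; apply: vect_comp_sub.
- by move=> c d _ _; apply: superbracket_vect.
- by move=> d nd; apply: vect_comp_out; lia.
move=> t v t_closed t_solvable g1t /vect_compP dv vt.
apply: (svect_not_solvable n_gt2 char2 dv t_closed t_solvable) => D /(subvP (svect_comp_sub _ _)) D1.
by apply/(subvP t_closed)/mem_superbracketv => //; apply: (subvP g1t).
Qed.

Lemma ms0_svect_maximal n (b : {vspace 'End(grassmann F n)}) : (2 < n)%N ->
  maximal_solvable_subalgebra (gcomp (svect F n) 0) b ->
  maximal_solvable (svect F n) (ms0 (svect F n) b).
Proof.
move=> n_gt2; apply: (@ms0_maximal_solvable F n (svect F n) n.+1) => //=; first by lia.
- by move=> d _; apply: capvS (vect_comp_sub _ _ _) (subvv _).
- by move=> c d _ _; apply: superbracket_svect.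
- move=> d nd; apply/eqP; rewrite -subv0 -(@vect_comp_out F n d); [exact: capvSl | lia].
move=> t v t_closed t_solvable g1t /(subvP (svect_comp_sub _ _)) /vect_compP dv vt.
apply: (svect_not_solvable n_gt2 char2 dv t_closed t_solvable) => D D1.
by apply/(subvP t_closed)/mem_superbracketv => //; apply: (subvP g1t).
Qed.

Section Twisted.
Variable n : nat.
Local Notation E := 'End(grassmann F n).
Implicit Types D : E.

(** Multiplication by the top monomial raises the degree by n. On fields of degree
at least 0 it is therefore zero, and on those of degree -1 it lands in the top
degree n - 1 of vect(0|n). *)
Lemma top_mul_derivation d D : homogeneous_derivation d D ->
  homogeneous_derivation (n%:Z + d) (amull (top_monomial F n) \o D)%VF.
Proof.
have htop : top_monomial F n \in homogeneous F n n%:Z.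
  by have := homogeneous_monomial F (setT : {set 'I_n}); rewrite cardsT card_ord.
move=> dD; have comp_sum (X : 'I_n -> E) (f : 'End(grassmann F n)) :
    (f \o (\sum_i X i))%VF = \sum_i (f \o X i)%VF.
  apply/lfunP => x; rewrite comp_lfunE !sum_lfunE linear_sum.
  by apply: eq_bigr => i _; rewrite comp_lfunE.
rewrite (homogeneous_derivation_sum dD) comp_sum; apply/vect_compP/memv_suml => i _.
apply/vect_compP; have -> : (amull (top_monomial F n) \o vfield F i (D (generator F i)))%VF =
    vfield F i (top_monomial F n * D (generator F i)).
  by apply/lfunP => x; rewrite comp_lfunE [in LHS]lfunE /= !vfieldE mulrA.
apply: vfield_derivation; rewrite -addrA; apply: homogeneousM htop _.
by rewrite addrC; apply: dD.1; apply: homogeneous_generator.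
Qed.

Lemma twistE D : twist F n D = D + (amull (top_monomial F n) \o D)%VF.
Proof.
rewrite lfunE /= /twist_fun; apply/lfunP => x.
by rewrite comp_lfunE add_lfunE comp_lfunE !lfunE /= mulrDl mul1r.
Qed.

Lemma twist_nonneg d D : 0 <= d -> homogeneous_derivation d D -> twist F n D = D.
Proof.
move=> d0 /top_mul_derivation/vect_compP; rewrite vect_comp_out; last by lia.
by rewrite memv0 twistE => /eqP->; rewrite addr0.
Qed.

(** The bracket of the additional summand Xi D of degree n - 1 with D' would have
degree n. *)
Lemma superbracket_twist D D' : homogeneous_derivation (-1) D ->
  homogeneous_derivation 1 D' -> superbracket (twist F n D) D' = superbracket D D'.
Proof.
move=> dD dD'; have := superbracket_derivation (top_mul_derivation dD) dD'.
move/vect_compP; rewrite vect_comp_out; last by lia.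
rewrite memv0 twistE => /eqP br0.
have := superbracketr_is_linear D' 1 D (amull (top_monomial F n) \o D)%VF.
by rewrite /superbracketr br0 !scale1r addr0.
Qed.

End Twisted.

Lemma tsvect_degree_m1 n v : v \in tsvect_comp F n (-1) ->
  exists2 v0, homogeneous_derivation (-1) v0 & v = twist F n v0.
Proof.
rewrite /tsvect_comp eqxx.
have -> : [seq twist F n (partial F i) | i : 'I_n] = map (twist F n) [seq partial F i | i : 'I_n].
  by rewrite -map_comp.
rewrite -limg_span => /memv_imgP[v0 hv0 ->]; exists v0 => //; apply/vect_compP.
apply: subvP hv0; apply/span_subvP => _ /imageP[i _ ->]; apply/vect_compP.
exact: partial_derivation.
Qed.

(** The degrees now stop at n - 2; since svect has no component of degree n - 1,
the components of degree at least 0 are the same as for svect. *)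
Lemma ms0_tsvect_maximal n (b : {vspace 'End(grassmann F n)}) : (2 < n)%N ->
  maximal_solvable_subalgebra (gcomp (tsvect F n) 0) b ->
  maximal_solvable (tsvect F n) (ms0 (tsvect F n) b).
Proof.
have tsvect_compE d : 0 <= d -> tsvect_comp F n d = svect_comp F n d.
  by rewrite /tsvect_comp; case: eqP => // ->.
move=> n_gt2; apply: (@ms0_maximal_solvable F n (tsvect F n) n) => //=.
- move=> d d0; rewrite tsvect_compE //; apply/subvP => D; rewrite memv_cap => /andP[Dd D0].
  rewrite -(twist_nonneg d0 (iffLR (vect_compP _ _) Dd)); apply: memv_img.
  by rewrite memv_cap D0 andbT (subvP (vect_comp_sub _ _ d)).
- by move=> c d c0 d0; rewrite !tsvect_compE ?addr_ge0 //; apply: superbracket_svect.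
- move=> d nd; rewrite tsvect_compE; last by lia.
  have [->|dn] := eqVneq d (n%:Z - 1); first exact: svect_comp_top.
  by apply/eqP; rewrite -subv0 -(@vect_comp_out F n d); [exact: capvSl | lia].
move=> t _ t_closed t_solvable g1t /tsvect_degree_m1[v dv ->] vt.
rewrite (@svect_not_solvable F n t v) ?linear0 // => D D1.
have /vect_compP dD := subvP (svect_comp_sub _ _) _ D1.
rewrite -(superbracket_twist dv dD).
apply/(subvP t_closed)/mem_superbracketv => //; apply: (subvP g1t).
by rewrite tsvect_compE.
Qed.

Section Hvect.
Variables k l : nat.
Local Notation n := (k + k + l)%N.

(** The index of the generator that is paired with a given one: it exchanges xi_a
with eta_a and fixes the zetas. *)
Definition dual_index (i : 'I_n) : 'I_n :=
  match split i with
  | inl j => match split j with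
             | inl a => eta_index l a
             | inr a => xi_index l a
             end
  | inr c => zeta_index k c
  end.

Lemma dual_xi a : dual_index (xi_index l a) = eta_index l a.
Proof. by rewrite /dual_index !(unsplitK (inl _)). Qed.

Lemma dual_eta a : dual_index (eta_index l a) = xi_index l a.
Proof. by rewrite /dual_index (unsplitK (inl _)) (unsplitK (inr _)). Qed.

Lemma dual_zeta c : dual_index (zeta_index k c) = zeta_index k c.
Proof. by rewrite /dual_index (unsplitK (inr _)). Qed.

Lemma dual_indexK : involutive dual_index.
Proof.
move=> i; rewrite {2}/dual_index; case: (split_ordP i) => [j ->|c ->]; last exact: dual_zeta.
by case: (split_ordP j) => [a|a] ->; [exact: dual_eta | exact: dual_xi].
Qed.

Lemma hamiltonianE f : hamiltonian F k l f = ham dual_index f.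
Proof.
rewrite lfunE /= /hamiltonian_fun /ham !big_split_ord big_split /=.
congr (_ + _ + _); apply: eq_bigr => i _.
- by rewrite -[lshift l (lshift k i)]/(xi_index l i) dual_xi.
- by rewrite -[lshift l (rshift k i)]/(eta_index l i) dual_eta.
- by rewrite -[rshift (k + k) i]/(zeta_index k i) dual_zeta.
Qed.

Lemma hvect_compP d D : D \in hvect_comp F k l d ->
  exists2 f, f \in homogeneous F n (d + 2) & D = ham dual_index f.
Proof. by case/memv_imgP => f hf ->; exists f; rewrite ?hamiltonianE. Qed.

Lemma ham_hvect_comp d f : f \in homogeneous F n (d + 2) ->
  ham dual_index f \in hvect_comp F k l d.
Proof. by move=> hf; rewrite -hamiltonianE memv_img. Qed.

Lemma ms0_hvect_maximal (b : {vspace 'End(grassmann F n)}) : (4 < n)%N ->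
  maximal_solvable_subalgebra (gcomp (hvect F k l) 0) b ->
  maximal_solvable (hvect F k l) (ms0 (hvect F k l) b).
Proof.
move=> n_gt4; apply: (@ms0_maximal_solvable F n (hvect F k l) n.+1) => //=; first by lia.
- by move=> d _; apply: limgS; apply: subvf.
- move=> c d _ _; apply/superbracketv_subP => _ _ /hvect_compP[f hf ->] /hvect_compP[g hg ->].
  rewrite (superbracket_ham dual_indexK hf hg); apply: ham_hvect_comp.
  rewrite (_ : c + d + 2 = d + 2 + (c + 2 - 2)); last by lia.
  by apply: (ham_derivation _ hf).1.
- move=> d nd; apply/eqP; rewrite -subv0; apply/subvP => _ /hvect_compP[f hf ->].
  by rewrite (homogeneous_out hf) ?linear0 ?mem0v //; lia.
move=> t _ t_closed t_solvable g1t /hvect_compP[u hu ->] vt.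
apply: (ham_not_solvable dual_indexK n_gt4 char2 hu t_closed t_solvable) => f hf.
apply/(subvP t_closed)/mem_superbracketv => //; apply: (subvP g1t).
exact: ham_hvect_comp.
Qed.

End Hvect.
End Algebras.

Theorem proposition4p1 (R : realType) :
  (forall (n : nat) (b : {vspace 'End(grassmann R[i] n)}),
     (2 < n)%N ->
     maximal_solvable_subalgebra (gcomp (vect R[i] n) 0) b ->
     maximal_solvable (vect R[i] n) (ms0 (vect R[i] n) b)) /\
  (forall (n : nat) (b : {vspace 'End(grassmann R[i] n)}),
     (2 < n)%N ->
     maximal_solvable_subalgebra (gcomp (svect R[i] n) 0) b ->
     maximal_solvable (svect R[i] n) (ms0 (svect R[i] n) b)) /\
  (forall (k l : nat) (b : {vspace 'End(grassmann R[i] (k + k + l))}),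
     (4 < k + k + l)%N ->
     maximal_solvable_subalgebra (gcomp (hvect R[i] k l) 0) b ->
     maximal_solvable (hvect R[i] k l) (ms0 (hvect R[i] k l) b)) /\
  (forall (n : nat) (b : {vspace 'End(grassmann R[i] (2 * n))}),
     (2 <= n)%N ->
     maximal_solvable_subalgebra (gcomp (tsvect R[i] (2 * n)) 0) b ->
     maximal_solvable (tsvect R[i] (2 * n)) (ms0 (tsvect R[i] (2 * n)) b)).
Proof.
have char2 : (2 : R[i]) != 0 by rewrite pnatr_eq0.
split; [|split; [|split]].
- by move=> n b; apply: ms0_vect_maximal.
- by move=> n b; apply: ms0_svect_maximal.
- by move=> k l b; apply: ms0_hvect_maximal.
- by move=> n b n_ge2; apply: ms0_tsvect_maximal => //; lia.
Qed.
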